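(* Suppose that either $(G,d(\cdot))$ is piecewise $\mathcal C^1$ with continuous reflection and $G$ is bounded, or $(G,d(\cdot))$ is polyhedral with piecewise constant reflection. If $\mathcal V\subset\partial G$ satisfies Assumption 2' and the drift and dispersion coefficients $b(\cdot)$ and $\sigma(\cdot)$ are continuous and uniformly bounded, then Assumption TF and Assumption V (stated in the context) are satisfied.
   Context: Notation: $\langle\cdot,\cdot\rangle$, $|\cdot|$ Euclidean; $B_r(x)=\{y\in\mathbb R^J:|y-x|\le r\}$, $\mathrm{dist}(y,A)=\inf_{z\in A}|y-z|$. $b:\mathbb R^J\to\mathbb R^J$, $\sigma:\mathbb R^J\to\mathbb R^{J\times N}$, $a=\sigma\sigma^T$, $\mathcal Lf=\sum_i b_i\partial_{x_i}f+\frac12\sum_{i,j}a_{ij}\partial^2_{x_ix_j}f$. Piecewise $\mathcal C^1$ with continuous reflection: $G=\bigcap_{i\in\mathcal I}G_i$ is a nonempty domain, $\mathcal I$ finite, each $G_i=\{x:\phi^i(x)>0\}$ with $\partial G_i=\{x:\phi^i(x)=0\}$ for some continuously differentiable $\phi^i$ on $\mathbb R^J$; $n^i(x)$ is the unit inward normal to $\partial G_i$ at $x\in\partial G_i$; $\mathcal I(x)=\{i\in\mathcal I:x\in\partial G_i\}$; $n(x)=\{\sum_{i\in\mathcal I(x)}s_in^i(x):s_i\ge0\}$ for $x\in\partial G$; for each $i$, $\gamma^i(\cdot)$ is a continuous vector field on $\partial G_i$ with $\langle n^i(x),\gamma^i(x)\rangle>0$, and $d(x)=\{\sum_{i\in\mathcal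 I(x)}s_i\gamma^i(x):s_i\ge0\}$ for $x\in\partial G$, $d(x)=\{0\}$ for $x\in G$. Polyhedral with piecewise constant reflection: additionally all $n^i(\cdot)$ and $\gamma^i(\cdot)$ are constant. $\mathcal U=\{x\in\partial G:\exists n\in n(x)\text{ with }\langle n,d\rangle>0\ \forall d\in d(x)\setminus\{0\}\}$. Assumption 2': $\mathcal V$ is a finite set with $\mathcal V\supset\partial G\setminus\mathcal U$, and for each $x\in\mathcal V$ there exist a unit vector $v_x$ and constants $r_x>0$, $\alpha_x>0$, $0<c^1_x<1<c^2_x<\infty$ such that, with $\Theta_x=\{z:\langle z,v_x\rangle\ge0\}$, for all $y\in\overline G\cap B_{r_x}(x)$: (1) $\langle v_x,y-x\rangle\ge\alpha_x|y-x|$; (2) $\gamma^i(y)\in\Theta_x$ for each $i\in\mathcal I(y)\subset\mathcal I(x)$; (3) for every $r\in(0,r_x/c^2_x)$, $\overline G\cap B_{c^1_xr}(x)\subseteq\{y\in\overline G\cap B_{r_x}(x):\mathrm{dist}(y,x+rv_x+\Theta_x)>0\}\subseteq\overline G\cap B_{c^2_xr}(x)$; (4) $v_x^Ta(y)v_x\ge\alpha_x$ for all $y\in B_{r_x}(x)$. Function spaces: $\mathcal C^2(\overline G)$ are restrictions to $\overline G$ of functions $\mathcal C^2$ on every open neighbourhood of $\overline G$; subscripts $b$, $c$ mean bounded with bounded derivatives up to order 2, resp. compact support; $\mathcal C^2_c(\overline G)\oplus\mathbb R$ are sums of a $\mathcal C^2_c(\overline G)$ function and a constant. $f$ is constant in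 a neighbourhood of $\mathcal V$ if it is constant near each point of $\mathcal V$. $\mathcal H=\{f\in\mathcal C^2_c(\overline G)\oplus\mathbb R: f\text{ constant in a neighbourhood of }\mathcal V,\ \langle d,\nabla f(y)\rangle\le0\ \forall d\in d(y),y\in\partial G\}$. Assumption TF: for each $\varepsilon>0$, $N\in\mathbb N$ there exist nonnegative $\{f_{x,\varepsilon}\in\mathcal C^2_b(\overline G):x\in\overline G\cap B_N(0)\}$ and constants $C(N,\varepsilon),c(N,\varepsilon)>0$ with: (1) each $f_{x,\varepsilon}$ is a finite or countable sum of functions in $\mathcal H\cap\mathcal C^2_c(\overline G)$; (2) $f_{x,\varepsilon}(y)=0$ if $|y-x|\le\varepsilon/2$ and $f_{x,\varepsilon}(y)>c(N,\varepsilon)$ if $|y-x|>3\varepsilon$, $y\in\overline G$; (3) $|\mathcal Lf_{x,\varepsilon}(y)|\le C(N,\varepsilon)$ for all $y\in\overline G$. Assumption V: $\mathcal V$ is finite and for each $x\in\mathcal V$ there exist a unit vector $v_x$ and $\alpha_x,r_x>0$ with $\langle v_x,y-x\rangle\ge\alpha_x|y-x|$, $v_x^Ta(y)v_x\ge\alpha_x$ and $\langle v_x,d\rangle\ge0$ for all $d\in d(y)$, $y\in\overline G\cap B_{r_x}(x)$. *)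

(* Defs.v *)
From HB Require Import structures.
From mathcomp Require Import all_boot all_order all_algebra.
From mathcomp Require Import all_classical all_reals all_analysis.
Set Implicit Arguments. Unset Strict Implicit. Unset Printing Implicit Defensive.
Import Order.TTheory GRing.Theory Num.Theory.
Import numFieldNormedType.Exports.
Local Open Scope classical_set_scope.
Local Open Scope ring_scope.

Section Defs.
Variables (R : realType) (J N : nat).
Notation vec := 'rV[R]_J.

Definition dotv (u v : vec) : R := \sum_(i < J) u 0 i * v 0 i.
Definition enorm (u : vec) : R := Num.sqrt (dotv u u).
Definition eball (x : vec) (r : R) : set vec := [set y | enorm (y - x) <= r].
Definition edist (y : vec) (A : set vec) : R := inf [set enorm (y - z) | z in A].
Definition bd (A : set vec) : set vec := closure A `\` A°.

Definition evec (i : 'I_J) : vec := delta_mx 0 i.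
Definition pd (i : 'I_J) (f : vec -> R) : vec -> R := fun x => 'D_(evec i) f x.
Definition grad (f : vec -> R) (x : vec) : vec := \row_i pd i f x.

Definition C1 (f : vec -> R) : Prop :=
  forall i, (forall x, derivable f x (evec i)) /\ continuous (pd i f).
Definition C2 (f : vec -> R) : Prop :=
  C1 f /\ forall i, C1 (pd i f).

Definition Lop (b : vec -> vec) (sigma : vec -> 'M[R]_(J, N)) (f : vec -> R)
  (y : vec) : R :=
  \sum_(i < J) b y 0 i * pd i f y
  + 2^-1 * \sum_(i < J) \sum_(j < J)
       (sigma y *m (sigma y)^T) i j * pd j (pd i f) y.

Variables (I : finType) (phi : I -> vec -> R) (gamma : I -> vec -> vec).

Definition Gi (i : I) : set vec := [set x | 0 < phi i x].
Definition G : set vec := \bigcap_(i in [set: I]) Gi i.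
Definition Gbar : set vec := closure G.
Definition bdG : set vec := bd G.
(* unit inward normal to dG_i = {phi^i = 0} *)
Definition nrm (i : I) (x : vec) : vec := (enorm (grad (phi i) x))^-1 *: grad (phi i) x.
Definition Iset (x : vec) : set I := [set i | phi i x = 0].
Definition ncone (x : vec) : set vec :=
  [set u | exists s : I -> R, (forall i, 0 <= s i) /\
      u = \sum_(i : I | `[< Iset x i >]) s i *: nrm i x].
Definition dcone (x : vec) : set vec :=
  [set u | (bdG x /\ exists s : I -> R, (forall i, 0 <= s i) /\
              u = \sum_(i : I | `[< Iset x i >]) s i *: gamma i x)
        \/ (G x /\ u = 0)].

Definition piecewise_C1_cont_refl : Prop :=
  G !=set0 /\ connected G /\
  (forall i, C1 (phi i)) /\
  (forall i, bd (Gi i) = [set x | phi i x = 0]) /\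
  (* the inward normal exists *)
  (forall i x, phi i x = 0 -> grad (phi i) x != 0) /\
  (forall i, {within [set x | phi i x = 0], continuous (gamma i)}) /\
  (forall i x, phi i x = 0 -> 0 < dotv (nrm i x) (gamma i x)).

Definition polyhedral_const_refl : Prop :=
  piecewise_C1_cont_refl /\
  forall i, exists (n0 g0 : vec), forall x, phi i x = 0 ->
      nrm i x = n0 /\ gamma i x = g0.

Definition Uset : set vec :=
  [set x | bdG x /\ exists2 n, ncone x n &
      forall d, dcone x d -> d != 0 -> 0 < dotv n d].

Definition Assumption2' (b : vec -> vec) (sigma : vec -> 'M[R]_(J, N))
  (V : set vec) : Prop :=
  finite_set V /\ bdG `\` Uset `<=` V /\
  forall x, V x -> exists (v : vec) (r alpha c1 c2 : R),
    [/\ enorm v = 1, 0 < r /\ 0 < alpha, 0 < c1 /\ c1 < 1, 1 < c2 &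
    [/\ forall y, Gbar y -> eball x r y -> alpha * enorm (y - x) <= dotv v (y - x),
        forall y, Gbar y -> eball x r y ->
          Iset y `<=` Iset x /\ forall i, Iset y i -> 0 <= dotv (gamma i y) v,
        forall rr, 0 < rr -> rr < r / c2 ->
          (Gbar `&` eball x (c1 * rr)) `<=`
            [set y | Gbar y /\ eball x r y /\
               0 < edist y [set x + rr *: v + z | z in [set z | 0 <= dotv z v]]]
          /\ [set y | Gbar y /\ eball x r y /\
               0 < edist y [set x + rr *: v + z | z in [set z | 0 <= dotv z v]]]
             `<=` (Gbar `&` eball x (c2 * rr)) &
        forall y, eball x r y ->
          alpha <= dotv v (v *m (sigma y *m (sigma y)^T))]].

(* function classes, for functions defined on R^J and considered on Gbar *)
Definition C2b (f : vec -> R) : Prop :=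
  C2 f /\ exists M : R, forall y, Gbar y ->
    `|f y| <= M /\ (forall i, `|pd i f y| <= M) /\
    (forall i j, `|pd j (pd i f) y| <= M).
Definition C2c (f : vec -> R) : Prop :=
  C2 f /\ exists K : set vec, compact K /\ forall y, Gbar y -> ~ K y -> f y = 0.
Definition C2c_plus_const (f : vec -> R) : Prop :=
  C2 f /\ exists c : R, exists K : set vec, compact K /\
    forall y, Gbar y -> ~ K y -> f y = c.
Definition const_near (V : set vec) (f : vec -> R) : Prop :=
  forall x, V x -> exists2 r : R, 0 < r &
    forall y z, Gbar y -> Gbar z -> eball x r y -> eball x r z -> f y = f z.
Definition Hclass (V : set vec) (f : vec -> R) : Prop :=
  C2c_plus_const f /\ const_near V f /\
  forall y d, bdG y -> dcone y d -> dotv d (grad f y) <= 0.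

Definition AssumptionTF (b : vec -> vec) (sigma : vec -> 'M[R]_(J, N))
  (V : set vec) : Prop :=
  forall (eps : R) (n : nat), 0 < eps ->
  exists (f : vec -> vec -> R) (C c : R), 0 < C /\ 0 < c /\
  forall x, Gbar x -> eball 0 n%:R x ->
    [/\ (forall y, Gbar y -> 0 <= f x y), C2b (f x),
        (exists g : nat -> vec -> R, (forall k, Hclass V (g k) /\ C2c (g k)) /\
           forall y, Gbar y -> (fun m => \sum_(0 <= k < m) g k y) @ \oo --> f x y),
        (forall y, Gbar y -> enorm (y - x) <= eps / 2 -> f x y = 0) /\
        (forall y, Gbar y -> 3 * eps < enorm (y - x) -> c < f x y) &
        forall y, Gbar y -> `|Lop b sigma (f x) y| <= C].

Definition AssumptionV (sigma : vec -> 'M[R]_(J, N)) (V : set vec) : Prop :=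
  finite_set V /\
  forall x, V x -> exists (v : vec) (alpha r : R),
    [/\ enorm v = 1, 0 < alpha, 0 < r &
      forall y, Gbar y -> eball x r y ->
        [/\ alpha * enorm (y - x) <= dotv v (y - x),
            alpha <= dotv v (v *m (sigma y *m (sigma y)^T)) &
            forall d, dcone y d -> 0 <= dotv v d]].

End Defs.

(* Main.v *)
Require Import Defs.
From HB Require Import structures.
From mathcomp Require Import all_boot all_order all_algebra.
From mathcomp Require Import all_classical all_reals all_analysis.
From mathcomp Require Import ring lra zify.
Set Implicit Arguments. Unset Strict Implicit. Unset Printing Implicit Defensive.
Import Order.TTheory GRing.Theory Num.Theory.
Import numFieldNormedType.Exports.
Local Open Scope classical_set_scope.
Local Open Scope ring_scope.

(** The test function [f_x] is a locally finite sum of bumps centred away from [x].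

    A bump at [z] is [chi h], with [chi] a nonincreasing C2 cutoff and [h] a quadratic
    function of [y - z] whose gradient is nonnegative on the reflection directions and
    whose sublevel sets in the closure of [G] shrink to [z].  At a point of [V] take
    [h = <v, y - z>]; elsewhere take [h = <n, y - z> + theta |y - z|^2 / r] with [n] in the
    cone of normals positive on the reflection cone, [theta] small and [r] the size of
    the bump.  Such a bump is constant near its centre, so it is admissible also there.

    It remains to choose the bumps with sizes and C2 norms under uniform control; a grid
    of cubes then selects a family with bounded overlap.  If [G] is bounded, this is
    compactness.  In the polyhedral case every [G_i] is a half-space and the normal [n]
    depends only on the set [K] of active faces.  Given well separated scales
    [s_0 << s_1 << ...], the set of faces within [s_j] of [y] is the same for two
    consecutive scales; Hoffman's bound (obtained by Fourier-Motzkin elimination)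
    then gives a point of the closure of [G] on exactly these faces at distance
    [O(s_j)] from [y], where a bump of size [s_(j+1) / 2] fits. *)

(** * Euclidean geometry of row vectors, and its topology *)

Section Euclid.
Variables (R : realType) (J : nat).
Notation vec := 'rV[R]_J.
Implicit Types (u v w x y z : vec).

Lemma dotvC u v : dotv u v = dotv v u.
Proof. by apply: eq_bigr => i _; rewrite mulrC. Qed.

Lemma dotvDl u v w : dotv (u + v) w = dotv u w + dotv v w.
Proof. by rewrite -big_split; apply: eq_bigr => i _; rewrite mxE mulrDl. Qed.

Lemma dotvZl (a : R) u v : dotv (a *: u) v = a * dotv u v.
Proof. by rewrite mulr_sumr; apply: eq_bigr => i _; rewrite mxE mulrA. Qed.

Lemma dotvNl u v : dotv (- u) v = - dotv u v.
Proof. by rewrite -scaleN1r dotvZl mulN1r. Qed.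

Lemma dotv0l v : dotv 0 v = 0.
Proof. by rewrite -(scale0r (0 : vec)) dotvZl mul0r. Qed.

Lemma dotvDr u v w : dotv w (u + v) = dotv w u + dotv w v.
Proof. by rewrite ![dotv w _]dotvC dotvDl. Qed.

Lemma dotvZr (a : R) u v : dotv v (a *: u) = a * dotv v u.
Proof. by rewrite ![dotv v _]dotvC dotvZl. Qed.

Lemma dotvNr u v : dotv v (- u) = - dotv v u.
Proof. by rewrite ![dotv v _]dotvC dotvNl. Qed.

Lemma dotv0r v : dotv v 0 = 0.
Proof. by rewrite dotvC dotv0l. Qed.

Lemma dotv_suml (T : finType) (P : pred T) (F : T -> vec) v :
  dotv (\sum_(i | P i) F i) v = \sum_(i | P i) dotv (F i) v.
Proof.
by elim/big_rec2: _ => [|i a b _ <-]; rewrite ?dotv0l ?dotvDl.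
Qed.

Lemma dotv_ge0 u : 0 <= dotv u u.
Proof. by apply: sumr_ge0 => i _; rewrite -expr2 sqr_ge0. Qed.

Lemma enorm_ge0 u : 0 <= enorm u.
Proof. exact: sqrtr_ge0. Qed.

Lemma enorm_sqr u : enorm u ^+ 2 = dotv u u.
Proof. by rewrite sqr_sqrtr ?dotv_ge0. Qed.

Lemma enorm0 : enorm (0 : vec) = 0.
Proof. by rewrite /enorm dotv0l sqrtr0. Qed.

Lemma enormN u : enorm (- u) = enorm u.
Proof. by rewrite /enorm dotvNl dotvNr opprK. Qed.

Lemma enorm_distC u v : enorm (u - v) = enorm (v - u).
Proof. by rewrite -enormN opprB. Qed.

Lemma ler_sqr_ge0 (a b : R) : 0 <= b -> a ^+ 2 <= b ^+ 2 -> a <= b.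
Proof. by move=> b0 h; nra. Qed.

Lemma enorm_coord u i : `|u 0 i| <= enorm u.
Proof.
apply: ler_sqr_ge0; rewrite ?enorm_ge0// enorm_sqr real_normK ?num_real//.
rewrite /dotv (bigD1 i)//= -expr2 lerDl.
by apply: sumr_ge0 => j _; rewrite -expr2 sqr_ge0.
Qed.

Lemma enorm_eq0 u : enorm u = 0 -> u = 0.
Proof.
move=> u0; apply/rowP => i; rewrite mxE; apply/eqP; rewrite -normr_le0 -u0.
exact: enorm_coord.
Qed.

Lemma enormZ (a : R) u : enorm (a *: u) = `|a| * enorm u.
Proof.
rewrite /enorm dotvZl dotvZr mulrA -expr2 sqrtrM ?sqr_ge0//.
by rewrite sqrtr_sqr.
Qed.

Lemma dotv_le u v : dotv u v <= enorm u * enorm v.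
Proof.
have [v0|v0] := eqVneq (enorm v) 0.
  by rewrite v0 mulr0 (enorm_eq0 v0) dotv0r.
apply: ler_sqr_ge0; first by rewrite mulr_ge0 ?enorm_ge0.
rewrite exprMn !enorm_sqr.
have := dotv_ge0 (dotv v v *: u - dotv u v *: v).
rewrite !(dotvDl, dotvDr, dotvNl, dotvNr, dotvZl, dotvZr) (dotvC v u).
have : 0 < dotv v v.
  by rewrite -enorm_sqr exprn_gt0// lt0r v0 enorm_ge0.
by set a := dotv u u; set b := dotv u v; set c := dotv v v => c0 h; nra.
Qed.

Lemma dotv_leN u v : - (enorm u * enorm v) <= dotv u v.
Proof. by rewrite lerNl -dotvNl -(enormN u) dotv_le. Qed.

Lemma ler_enormD u v : enorm (u + v) <= enorm u + enorm v.
Proof.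
apply: ler_sqr_ge0; first by rewrite addr_ge0 ?enorm_ge0.
rewrite sqrrD !enorm_sqr !dotvDl !dotvDr (dotvC v u).
by have := dotv_le u v; lra.
Qed.

Lemma ler_edistD w u v : enorm (u - v) <= enorm (u - w) + enorm (w - v).
Proof. by rewrite (le_trans _ (ler_enormD _ _))// addrA subrK. Qed.

Lemma enorm_le_sum u (m : R) : (forall i, `|u 0 i| <= m) ->
  0 <= m -> enorm u <= J%:R * m.
Proof.
move=> um m0; apply: ler_sqr_ge0; first by rewrite mulr_ge0.
rewrite enorm_sqr; apply: (@le_trans _ _ (\sum_(i < J) m ^+ 2)).
  apply: ler_sum => i _; rewrite -expr2 -(real_normK (num_real _)).
  by rewrite ler_sqr ?nnegrE.
rewrite sumr_const card_ord -[leLHS]mulr_natl exprMn ler_wpM2r ?sqr_ge0//.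
by rewrite -natrX ler_nat; case: J => // n; rewrite expnS leq_pmulr// expn_gt0.
Qed.

Lemma mx_coord_le u i : `|u 0 i| <= `|u|.
Proof.
rewrite [leRHS]/Num.norm/= mx_normrE.
by apply/bigmax_geP; right; exists (0, i).
Qed.

Lemma enorm_le_mx u : enorm u <= J%:R * `|u|.
Proof. by apply: enorm_le_sum => // i; exact: mx_coord_le. Qed.

Lemma mx_le_enorm u : `|u| <= enorm u.
Proof.
rewrite [leLHS]/Num.norm/= mx_normrE; apply/bigmax_leP; split.
  exact: enorm_ge0.
by move=> [i j] _ /=; rewrite ord1; exact: enorm_coord.
Qed.

(** The topology of ['rV[R]_J] comes from the sup norm, which is at most [enorm], while [enorm] is
    at most [J] times it. Dividing by [J%:R + 1] rather than [J%:R] covers [J = 0]. *)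
Lemma nbhs_enormP (A : set vec) x :
  nbhs x A <-> exists2 r : R, 0 < r & forall y, enorm (y - x) <= r -> A y.
Proof.
rewrite -nbhs_ballE; split=> [[/= e e0]|[r r0 h]].
  rewrite -ball_normE => h; exists (e / 2); first by rewrite divr_gt0.
  move=> y yx; apply: h => /=; rewrite distrC.
  by apply: le_lt_trans (mx_le_enorm _) _; rewrite /= in e0; lra.
exists (r / (J%:R + 1)) => /=; first by rewrite divr_gt0// ltr_wpDl.
rewrite -ball_normE => y /= yx; apply: h.
rewrite enorm_distC; apply: le_trans (enorm_le_mx _) _.
move: yx; rewrite ltr_pdivlMr ?ltr_wpDl// => /ltW; apply: le_trans.
by rewrite mulrDr mulr1 mulrC lerDl.
Qed.

Lemma closure_enormP (A : set vec) x : closure A x <->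
  forall r : R, 0 < r -> exists2 y, A y & enorm (y - x) <= r.
Proof.
split=> [h r r0|h B]; last first.
  move=> /(proj1 (nbhs_enormP _ _))[r r0 hB].
  by have [y Ay yx] := h _ r0; exists y; split => //; exact: hB.
have [|y [Ay hy]] := h [set y | enorm (y - x) <= r].
  by apply/nbhs_enormP; exists r.
by exists y.
Qed.

Lemma cvg_enormP (f : vec -> R) x : {for x, continuous f} <->
  forall e : R, 0 < e -> exists2 r : R, 0 < r &
    forall y, enorm (y - x) <= r -> `|f y - f x| <= e.
Proof.
rewrite /prop_for /continuous_at (@cvgrPdist_le _ R vec (nbhs x) (nbhs_filter x)).
split=> h e /h.
  move=> /(proj1 (nbhs_enormP _ _))[r r0 hr]; exists r => // y /hr.
  by rewrite distrC.
move=> [r r0 hr]; apply/nbhs_enormP; exists r => // y /hr.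
by rewrite distrC.
Qed.

Lemma closed_eball x (r : R) : closed (eball x r).
Proof.
move=> y /closure_enormP h; rewrite /eball/=; apply/ler_addgt0Pr => e e0.
have [w wx wy] := h _ e0.
have := ler_edistD w y x; rewrite (enorm_distC y w).
by rewrite /eball/= in wx; lra.
Qed.

Lemma compact_sub_eball (A : set vec) x (r : R) :
  closed A -> A `<=` eball x r -> compact A.
Proof.
move=> cA Ar; apply: bounded_closed_compact => //.
exists (r + enorm x); split; first exact: num_real.
move=> M rM y /Ar yx; apply: le_trans (mx_le_enorm _) _.
have := ler_enormD (y - x) x; rewrite subrK.
by rewrite /eball/= in yx; lra.
Qed.

Lemma compact_eball x (r : R) : compact (eball x r).
Proof. by apply: (@compact_sub_eball _ x r) => //; exact: closed_eball. Qed.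

End Euclid.

(** * Calculus of [C1] and [C2] functions given by partial derivatives *)

Section Calculus.
Variables (R : realType) (J : nat).
Notation vec := 'rV[R]_J.
Implicit Types (u v x y z : vec) (f g : vec -> R).

(** Restriction to a line turns directional derivatives into derivatives in one real variable, where
    the chain rule and the mean value theorem apply. *)
Lemma is_derive_lineP f x v (d t : R) :
  is_derive (x + t *: v) v f d <-> is_derive t 1 (fun s : R => f (x + s *: v)) d.
Proof.
have E : (fun h : R => h^-1 *: ((f \o shift (x + t *: v)) (h *: v) - f (x + t *: v)))
   = (fun h : R => h^-1 *: (((fun s : R => f (x + s *: v)) \o shift t) (h *: 1)
         - (fun s : R => f (x + s *: v)) t)).
  apply/funext => h /=; congr (_ *: (f _ - _)).
  by rewrite [h%:A]mulr1 scalerDl addrCA.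
by split=> -[h1 h2]; split; move: h1 h2; rewrite /derivable /derive E.
Qed.

Lemma is_derive_line0 f x v (d : R) :
  is_derive x v f d <-> is_derive (0 : R) (1 : R) (fun s : R => f (x + s *: v)) d.
Proof. by rewrite -is_derive_lineP scale0r addr0. Qed.

Lemma line_MVT f x v (t : R) : (forall y, derivable f y v) ->
  exists2 c : R, `|c| <= `|t| & f (x + t *: v) - f x = 'D_v f (x + c *: v) * t.
Proof.
move=> df.
have dF (s : R) : is_derive s (1 : R) (fun s : R => f (x + s *: v)) ('D_v f (x + s *: v)).
  by apply/is_derive_lineP/derivableP.
have cF A : {within A, continuous (fun s : R => f (x + s *: v))}.
  apply: continuous_subspaceT => s; apply: differentiable_continuous.
  by apply/derivable1_diffP; apply: ex_derive.
have [t0|t0] := leP 0 t.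
  have [c ct E] := MVT_segment t0 (fun s _ => dF s) (@cF _).
  exists c; last by move: E; rewrite scale0r addr0 subr0.
  by move: ct; rewrite in_itv/= => /andP[c0 ct]; rewrite !ger0_norm.
have [c ct E] := MVT_segment (ltW t0) (fun s _ => dF s) (@cF _).
exists c.
  move: ct; rewrite in_itv/= => /andP[ct c0].
  by rewrite (ler0_norm c0) (ltr0_norm t0) lerN2.
by move: E; rewrite scale0r addr0 sub0r mulrN => E; rewrite -[RHS]opprK -E opprB.
Qed.

(** [C1] speaks of partial derivatives only, so coordinates are changed one at a time, with the mean
    value theorem applied to each change. *)
Lemma C1_expansion f z (e : R) : C1 f -> 0 < e -> exists2 r : R, 0 < r &
  forall u, enorm u <= r -> `|f (z + u) - f z - dotv (grad f z) u| <= e * enorm u.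
Proof.
move=> f1 e0; pose e' := e / (J%:R + 1).
have e'0 : 0 < e' by rewrite divr_gt0// ltr_wpDl.
have [r r0 hr] : exists2 r : R, 0 < r & forall i y, enorm (y - z) <= r ->
    `|pd i f y - pd i f z| <= e'.
  have : \forall y \near z, forall i, `|pd i f y - pd i f z| <= e'.
    apply: (@filter_forall _ _ (fun i y => `|pd i f y - pd i f z| <= e') (nbhs z)) => i.
    have [r r0 hr] := proj1 (cvg_enormP (pd i f) z) ((f1 i).2 z) _ e'0.
    by apply/nbhs_enormP; exists r.
  by move=> /(proj1 (nbhs_enormP _ _))[r r0 hr]; exists r => // i y /hr; exact.
exists (r / (J%:R + 1)); first by rewrite divr_gt0// ltr_wpDl.
move=> u; rewrite ler_pdivlMr ?ltr_wpDl// => ur.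
(* [tr k] keeps the first [k] coordinates of [u]; the increments of [f] along these points
   telescope. *)
pose tr k : vec := \row_i (if (i < k)%N then u 0 i else 0).
have trE : u = tr J by apply/rowP => i; rewrite mxE ltn_ord.
have tr0 : tr 0%N = 0 by apply/rowP => i; rewrite !mxE.
have trS (k : 'I_J) : tr k.+1 = tr k + u 0 k *: evec R k.
  apply/rowP => i; rewrite !mxE eqxx/= ltnS leq_eqVlt.
  have [->|ik] := eqVneq i k; first by rewrite eqxx ltnn add0r mulr1.
  by rewrite (negbTE (_ : (i != k :> nat)%N)) ?val_eqE//= mulr0 addr0.
have -> : f (z + u) - f z = \sum_(k < J) (f (z + tr k.+1) - f (z + tr k)).
  rewrite -(big_mkord xpredT (fun k => f (z + tr k.+1) - f (z + tr k))).
  rewrite (@telescope_sumr _ 0 J (fun k => f (z + tr k)))//.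
  by rewrite tr0 addr0 -trE.
rewrite /dotv -sumrB; apply: le_trans (ler_norm_sum _ _ _) _.
apply: (@le_trans _ _ (\sum_(k < J) e' * enorm u)); last first.
  rewrite sumr_const card_ord -mulr_natl mulrA ler_wpM2r ?enorm_ge0//.
  rewrite /e' mulrCA -[leRHS]mulr1 (ler_pM2l e0).
  by rewrite ler_pdivrMr ?ltr_wpDl// mul1r lerDl.
apply: ler_sum => k _; rewrite trS addrA.
have [c cu ->] := line_MVT (z + tr k) (u 0 k) (fun y => (f1 k).1 y).
rewrite -/(pd k f _) mxE -mulrBl normrM.
rewrite ler_pM//; last exact: enorm_coord.
apply: hr; apply: le_trans ur; rewrite addrAC [z + _ + _]addrC addKr mulrC.
apply: le_trans (_ : J%:R * enorm u <= _); last by rewrite mulrDl mul1r lerDl enorm_ge0.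
apply: enorm_le_sum; last exact: enorm_ge0.
move=> i; rewrite !mxE eqxx/=.
have [->|ik] := eqVneq i k.
  by rewrite ltnn add0r mulr1; exact: le_trans cu (enorm_coord _ _).
rewrite mulr0 addr0; case: ifP => _; first exact: enorm_coord.
by rewrite normr0 enorm_ge0.
Qed.

Lemma C1_continuous f : C1 f -> continuous f.
Proof.
move=> f1 z; apply: (proj2 (cvg_enormP _ _)) => e e0.
have [r r0 hr] := C1_expansion z f1 ltr01.
pose M := 1 + enorm (grad f z).
have M0 : 0 < M by rewrite ltr_pwDl// enorm_ge0.
exists (Num.min r (e / M)); first by rewrite lt_min r0 divr_gt0.
move=> y; rewrite le_min => /andP[/hr]; rewrite [z + _]addrC subrK ler_pdivlMr//.
have := dotv_le (grad f z) (y - z); have := dotv_leN (grad f z) (y - z).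
rewrite !ler_norml /M mulrDr => ? ? /andP[? ?] ?; apply/andP; split; lra.
Qed.

Lemma continuous_addf f g : continuous f -> continuous g -> continuous (fun x => f x + g x).
Proof. by move=> cf cg x; exact: (continuousD (cf x) (cg x)). Qed.

Lemma continuous_mulf f g : continuous f -> continuous g -> continuous (fun x => f x * g x).
Proof. by move=> cf cg x; exact: (continuousM (cf x) (cg x)). Qed.

Lemma C1_of f (df : 'I_J -> vec -> R) :
  (forall i x, is_derive x (evec R i) f (df i x)) -> (forall i, continuous (df i)) -> C1 f.
Proof.
move=> h c i; split=> [x|]; first by apply: ex_derive.
by rewrite (_ : pd i f = df i)//; apply/funext => x; apply: derive_val.
Qed.

Lemma C2_of f (df : 'I_J -> vec -> R) :
  (forall i x, is_derive x (evec R i) f (df i x)) -> (forall i, C1 (df i)) -> C2 f.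
Proof.
move=> h c; split; first by apply: (C1_of h) => i; exact: C1_continuous.
by move=> i; rewrite (_ : pd i f = df i)//; apply/funext => x; apply: derive_val.
Qed.

Lemma C1_is_derive f i x : C1 f -> is_derive x (evec R i) f (pd i f x).
Proof. by move=> /(_ i)[h _]; exact: derivableP. Qed.

Lemma C1_cst (a : R) : C1 (fun _ : vec => a).
Proof.
by apply: (@C1_of _ (fun _ _ => 0)) => i; exact: cst_continuous.
Qed.

Lemma C2_cst (a : R) : C2 (fun _ : vec => a).
Proof.
by apply: (@C2_of _ (fun _ _ => 0)) => i; exact: C1_cst.
Qed.

Lemma C1D f g : C1 f -> C1 g -> C1 (fun x => f x + g x).
Proof.
move=> hf hg; apply: (@C1_of _ (fun i x => pd i f x + pd i g x)) => [i x|i].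
  by apply: is_deriveD; exact: C1_is_derive.
by apply: continuous_addf; [exact: (hf i).2|exact: (hg i).2].
Qed.

Lemma C2D f g : C2 f -> C2 g -> C2 (fun x => f x + g x).
Proof.
move=> [f1 f2] [g1 g2]; apply: (@C2_of _ (fun i x => pd i f x + pd i g x)) => [i x|i].
  by apply: is_deriveD; exact: C1_is_derive.
exact: C1D.
Qed.

Lemma C1M f g : C1 f -> C1 g -> C1 (fun x => f x * g x).
Proof.
move=> hf hg.
apply: (@C1_of _ (fun i x => f x * pd i g x + g x * pd i f x)) => [i x|i].
  by apply: is_deriveM; exact: C1_is_derive.
apply: continuous_addf; apply: continuous_mulf.
- exact: C1_continuous.
- exact: (hg i).2.
- exact: C1_continuous.
- exact: (hf i).2.
Qed.

Lemma is_pdM f g i x : C1 f -> C1 g ->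
  is_derive x (evec R i) (fun x => f x * g x) (f x * pd i g x + g x * pd i f x).
Proof. by move=> hf hg; apply: is_deriveM; exact: C1_is_derive. Qed.

Lemma C2M f g : C2 f -> C2 g -> C2 (fun x => f x * g x).
Proof.
move=> [f1 f2] [g1 g2].
apply: (@C2_of _ (fun i x => f x * pd i g x + g x * pd i f x)) => [i x|i].
  exact: is_pdM.
by apply: C1D; apply: C1M.
Qed.

Lemma is_pd_comp (c dc : R -> R) f i x : (forall t : R, is_derive t (1 : R) c (dc t)) -> C1 f ->
  is_derive x (evec R i) (fun y => c (f y)) (dc (f x) * pd i f x).
Proof.
move=> hc hf; apply/is_derive_line0.
have h := proj1 (is_derive_line0 f x (evec R i) (pd i f x)) (C1_is_derive i x hf).
apply: (is_derive_eq (is_derive1_comp (f := c) (a := dc (f x)) _ _)).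
  by rewrite scale0r addr0.
by rewrite mulrC.
Qed.

Lemma C1_comp (c dc : R -> R) f : (forall t : R, is_derive t (1 : R) c (dc t)) ->
  continuous dc -> C1 f -> C1 (fun y => c (f y)).
Proof.
move=> hc dcc hf; apply: (C1_of (df := fun i x => dc (f x) * pd i f x)) => [i x|i].
  exact: is_pd_comp.
apply: continuous_mulf; last exact: (hf i).2.
by move=> x; apply: continuous_comp; [exact: C1_continuous|exact: dcc].
Qed.

Lemma C2_comp (c dc ddc : R -> R) f : (forall t : R, is_derive t (1 : R) c (dc t)) ->
  (forall t : R, is_derive t (1 : R) dc (ddc t)) -> continuous ddc -> C2 f -> C2 (fun y => c (f y)).
Proof.
move=> hc hdc cc [f1 f2]; apply: (C2_of (df := fun i x => dc (f x) * pd i f x)) => [i x|i].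
  exact: is_pd_comp.
by apply: C1M => //; apply: C1_comp hdc cc f1.
Qed.

Lemma C2_sum (T : Type) (s : seq T) (F : T -> vec -> R) :
  (forall k, C2 (F k)) -> C2 (fun y => \sum_(k <- s) F k y).
Proof.
move=> hF; elim: s => [|k s IH].
  by under eq_fun do rewrite big_nil; exact: C2_cst.
by under eq_fun do rewrite big_cons; exact: (C2D (hF k) IH).
Qed.

Lemma is_derive_coord (k : 'I_J) x v : is_derive x v (fun y : vec => y 0 k) (v 0 k).
Proof.
apply/is_derive_line0.
rewrite (_ : (fun _ => _) = (fun s : R => x 0 k + s * v 0 k)).
  apply: is_derive_eq; rewrite /= ?add0r ?scale0r ?add0r ?addr0 ?mul1r.
  by rewrite ?[_%:A]mulr1 ?scaler0 ?addr0.
by apply/funext => s; rewrite !mxE.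
Qed.

Lemma C2_coord (k : 'I_J) : C2 (fun y : vec => y 0 k).
Proof.
apply: (C2_of (df := fun i _ => evec R i 0 k)) => [i x|i].
  exact: is_derive_coord.
exact: C1_cst.
Qed.

Lemma C2_translate f z : C2 f -> C2 (fun y => f (y - z)) /\
  (forall i y, pd i (fun y => f (y - z)) y = pd i f (y - z)) /\
  (forall i j y, pd j (pd i (fun y => f (y - z))) y = pd j (pd i f) (y - z)).
Proof.
have tr g i y : C1 g -> is_derive y (evec R i) (fun y => g (y - z)) (pd i g (y - z)).
  move=> hg; apply/is_derive_line0.
  under eq_fun do rewrite addrAC.
  exact/is_derive_line0/C1_is_derive.
have C1tr g : C1 g -> C1 (fun y => g (y - z)).
  move=> hg; apply: (C1_of (df := fun i y => pd i g (y - z))) => [i y|i y]; first exact: tr.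
  apply: (proj2 (cvg_enormP _ _)) => e e0.
  have [r r0 hr] := proj1 (cvg_enormP (pd i g) (y - z)) ((hg i).2 _) e e0.
  by exists r => // w wy; apply: hr; rewrite opprB addrA subrK.
move=> [f1 f2].
have E i : pd i (fun y => f (y - z)) = (fun y => pd i f (y - z)).
  by apply/funext => y; have h := tr f i y f1; exact: derive_val.
split.
  by apply: (C2_of (df := fun i y => pd i f (y - z))) => [i y|i]; [exact: tr|exact: C1tr].
split=> [i y|i j y]; first by rewrite E.
by rewrite E; have h := tr _ j y (f2 i); exact: derive_val.
Qed.

Lemma near_eq_pd f g i x : (\forall y \near x, f y = g y) ->
  \forall y \near x, pd i f y = pd i g y.
Proof.
move=> /near_join h; near=> y.
by apply: near_eq_derive; near: y.
Unshelve. all: by end_near. Qed.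

Lemma near_eqC f g x : (\forall y \near x, f y = g y) -> \forall y \near x, g y = f y.
Proof.
move=> /(proj1 (nbhs_enormP _ _))[r r0 hr]; apply/nbhs_enormP.
by exists r => // y /hr ->.
Qed.

(** Partial derivatives depend on germs only. This serves the locally finite sums, which are finite
    sums near each point. *)
Lemma C2_local f : (forall x, exists2 g, C2 g & \forall y \near x, f y = g y) -> C2 f.
Proof.
have loc1 h : (forall x, exists2 g, C1 g & \forall y \near x, h y = g y) -> C1 h.
  move=> hh i; split=> x; have [g g1 hg] := hh x.
    exact: (near_eq_derivable (near_eqC hg)) ((g1 i).1 x).
  have /(proj1 (nbhs_enormP _ _))[r r0 hr] := near_eq_pd i hg.
  apply: (proj2 (cvg_enormP _ _)) => e e0.
  have [r' r'0 hr'] := proj1 (cvg_enormP (pd i g) x) ((g1 i).2 x) e e0.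
  exists (Num.min r r'); first by rewrite lt_min r0.
  move=> y; rewrite le_min => /andP[yr /hr'].
  by rewrite !hr// subrr enorm0 ltW.
move=> hf; split; first by apply: loc1 => x; have [g [g1 _] hg] := hf x; exists g.
move=> i; apply: loc1 => x; have [g [_ g2] hg] := hf x; exists (pd i g) => //.
exact: near_eq_pd.
Qed.

Definition C2_bounded_by f (B : R) := forall y, `|f y| <= B /\
  (forall i, `|pd i f y| <= B) /\ (forall i j, `|pd j (pd i f) y| <= B).

Lemma C2_bounded_by_le f (B B' : R) : B <= B' -> C2_bounded_by f B -> C2_bounded_by f B'.
Proof.
move=> BB' h y; have [h1 [h2 h3]] := h y.
by split; [|split=> [i|i j]]; apply: le_trans BB'.
Qed.

Lemma continuous_support_bounded f z (r : R) : continuous f ->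
  (forall y, r < enorm (y - z) -> f y = 0) -> exists B : R, forall y, `|f y| <= B.
Proof.
move=> cf f0.
have cabs : {within eball z r, continuous (fun y => `|f y|)}.
  apply: continuous_subspaceT => y.
  by apply: continuous_comp; [exact: cf|exact: norm_continuous].
have [[y0 hy0]|ne] := pselect (eball z r !=set0); last first.
  exists 0 => y; rewrite f0 ?normr0// ltNge; apply/negP => h.
  by apply: ne; exists y.
have [|c _ hc] := compact_EVT_max _ (@compact_eball _ _ z r) cabs; first by exists y0.
exists `|f c| => y; have [yr|yr] := leP (enorm (y - z)) r; last by rewrite f0// normr0.
by apply: hc; rewrite inE.
Qed.

(** Each derivative up to order two is continuous and vanishes outside the closed ball, hence is
    bounded by compactness; the finitely many bounds are added up. *)
Lemma C2_support_bounded f z (r : R) : C2 f ->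
  (forall y, r <= enorm (y - z) -> f y = 0) -> exists B : R, C2_bounded_by f B.
Proof.
move=> [f1 f2] f0.
have pd0 (h : vec -> R) i : (forall y, r < enorm (y - z) -> h y = 0) ->
    forall y, r < enorm (y - z) -> pd i h y = 0.
  move=> h0 y yr; rewrite /pd (@near_eq_derive _ _ _ _ (cst 0)) ?derive_cst//.
  apply/nbhs_enormP; exists ((enorm (y - z) - r) / 2); first by lra.
  by move=> w wy; apply: h0; have := ler_edistD w y z; rewrite (enorm_distC y w); lra.
have f0' y : r < enorm (y - z) -> f y = 0 by move=> /ltW; exact: f0.
have [B0 h0] := continuous_support_bounded (C1_continuous f1) f0'.
have /choice [B1 h1] i := continuous_support_bounded (f1 i).2 (pd0 _ i f0').
have /choice [B2 h2] (ij : 'I_J * 'I_J) :=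
  continuous_support_bounded (f2 ij.1 ij.2).2 (pd0 _ ij.2 (pd0 _ ij.1 f0')).
have B1ge i : 0 <= B1 i := le_trans (normr_ge0 _) (h1 i 0).
have B2ge i : 0 <= B2 i := le_trans (normr_ge0 _) (h2 i 0).
have B0ge : 0 <= B0 := le_trans (normr_ge0 _) (h0 0).
have S1 : 0 <= \sum_i B1 i by exact: sumr_ge0.
have S2 : 0 <= \sum_i B2 i by exact: sumr_ge0.
exists (B0 + \sum_i B1 i + \sum_ij B2 ij) => y; split; last split=> [i|i j].
- by apply: le_trans (h0 y) _; lra.
- apply: le_trans (h1 i y) _; rewrite (bigD1 i)//=.
  have hs : 0 <= \sum_(j | j != i) B1 j by exact: sumr_ge0.
  by lra.
- apply: le_trans (h2 (i, j) y) _; rewrite [\sum_ij B2 ij](bigD1 (i, j))//=.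
  have hs : 0 <= \sum_(ij | ij != (i, j)) B2 ij by exact: sumr_ge0.
  by lra.
Qed.

End Calculus.

(** * A nonincreasing C2 cutoff on the real line *)

Section Cutoff.
Variable R : realType.

Definition pospart (t : R) : R := Num.max t 0.

Lemma pospartE (t : R) : (t <= 0 /\ pospart t = 0) \/ (0 <= t /\ pospart t = t).
Proof.
rewrite /pospart; have [h|h] := leP t 0; first by left.
by right; rewrite ltW.
Qed.

(** A quadratic remainder bound involves no limit, so for powers of the positive part it can be
    checked by cases on signs. *)
Lemma is_derive_quadratic_error (f : R -> R) (t d : R) :
  (forall h : R, `|f (h + t) - f t - d * h| <= h ^+ 2) -> is_derive t 1 f d.
Proof.
move=> H.
have cv : (fun h : R => h^-1 *: ((f \o shift t) (h *: 1) - f t)) @ 0^' --> d.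
  apply/cvgrPdist_le => e e0; near=> h.
  have h0 : h != 0 by near: h; exact: nbhs_dnbhs_neq.
  rewrite /= [h%:A]mulr1 distrC.
  have -> : h^-1 *: (f (h + t) - f t) - d = h^-1 * (f (h + t) - f t - d * h).
    by rewrite /GRing.scale/=; field.
  rewrite normrM normfV ler_pdivrMl ?normr_gt0//; apply: le_trans (H h) _.
  rewrite -real_normK ?num_real// expr2 ler_wpM2l//.
  by near: h; apply: dnbhs0_le.
split; last exact: cvg_lim cv.
by apply/cvg_ex; exists d.
Unshelve. all: by end_near. Qed.

Lemma is_derive_pos2 (t : R) : is_derive t 1 (fun s => pospart s ^+ 2) (2 * pospart t).
Proof.
apply: is_derive_quadratic_error => h; rewrite ler_norml.
case: (pospartE t) => -[? ->]; case: (pospartE (h + t)) => -[? ->]; apply/andP; split; nra.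
Qed.

Lemma is_derive_pos3 (t : R) : is_derive t 1 (fun s => pospart s ^+ 3) (3 * pospart t ^+ 2).
Proof.
rewrite (_ : (fun s => _) = (fun s => s * pospart s ^+ 2)).
  have h := is_deriveM (is_derive_id t 1) (is_derive_pos2 t).
  apply: is_derive_eq h _; rewrite /GRing.scale/=.
  by case: (pospartE t) => -[? ->]; ring.
by apply/funext => s; case: (pospartE s) => -[? ->]; ring.
Qed.

(* An integrated quadratic B-spline with knots 1, 2, 3, 4. *)
Definition chi (t : R) : R :=
  1 - (pospart (t - 1) ^+ 3 - 3 * pospart (t - 2) ^+ 3 + 3 * pospart (t - 3) ^+ 3
       - pospart (t - 4) ^+ 3) / 6.

Definition dchi (t : R) : R :=
  - (pospart (t - 1) ^+ 2 - 3 * pospart (t - 2) ^+ 2 + 3 * pospart (t - 3) ^+ 2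
       - pospart (t - 4) ^+ 2) / 2.

Definition ddchi (t : R) : R :=
  - (pospart (t - 1) - 3 * pospart (t - 2) + 3 * pospart (t - 3) - pospart (t - 4)).

Lemma is_derive_comb (f df : R -> R) (a b c0 : R) :
  (forall t : R, is_derive t 1 f (df t)) -> forall t : R,
  is_derive t 1 (fun t => c0 + a * (f (t - 1) - b * f (t - 2) + b * f (t - 3) - f (t - 4)))
    (a * (df (t - 1) - b * df (t - 2) + b * df (t - 3) - df (t - 4))).
Proof.
move=> hf t.
have hs (k : R) : is_derive t (1 : R) (fun t : R => f (t - k)) (df (t - k)).
  have h : is_derive t (1 : R) (fun s : R => s - k) (1 : R).
    by apply: is_derive_eq; rewrite subr0.
  apply: (is_derive_eq (is_derive1_comp (f := f) (g := fun s => s - k) (hf (t - k)) h)).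
  by rewrite ?mul1r ?mulr1.
apply: is_derive_eq (is_deriveD (is_derive_cst c0 _ _) (is_deriveM (is_derive_cst a _ _)
  (is_deriveB (is_deriveD (is_deriveB (hs 1) (is_deriveM (is_derive_cst b _ _) (hs 2)))
   (is_deriveM (is_derive_cst b _ _) (hs 3))) (hs 4)))) _.
by rewrite /GRing.scale/=; ring.
Qed.

Lemma is_derive_chi (t : R) : is_derive t 1 chi (dchi t).
Proof.
have h := is_derive_comb (- 6^-1) 3 1 is_derive_pos3 t.
rewrite (_ : chi = (fun t => 1 + - 6^-1 * (pospart (t - 1) ^+ 3 - 3 * pospart (t - 2) ^+ 3
   + 3 * pospart (t - 3) ^+ 3 - pospart (t - 4) ^+ 3))).
  by apply: is_derive_eq h _; rewrite /dchi; field.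
by apply/funext => s; rewrite /chi; field.
Qed.

Lemma is_derive_dchi (t : R) : is_derive t 1 dchi (ddchi t).
Proof.
have h := is_derive_comb (- 2^-1) 3 0 is_derive_pos2 t.
rewrite (_ : dchi = (fun t => 0 + - 2^-1 * (pospart (t - 1) ^+ 2 - 3 * pospart (t - 2) ^+ 2
   + 3 * pospart (t - 3) ^+ 2 - pospart (t - 4) ^+ 2))).
  by apply: is_derive_eq h _; rewrite /ddchi; field.
by apply/funext => s; rewrite /dchi; field.
Qed.

Lemma ddchi_continuous : continuous ddchi.
Proof.
have cp (k : R) : continuous (fun t : R => pospart (t - k)).
  move=> t; apply: (@continuous_comp _ _ _ (fun t => t - k) pospart).
    by apply: cvgB; [exact: cvg_id|exact: cvg_cst].
  apply/cvgrPdist_le => e e0; near=> s.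
  have : `|t - k - s| <= e by near: s; apply: cvgr_dist_le.
  rewrite !ler_norml.
  case: (pospartE s) => -[? ->]; case: (pospartE (t - k)) => -[? ->] /andP[? ?];
    by apply/andP; split; lra.
move=> t; apply: cvgN; apply: cvgB; last exact: cp.
apply: cvgD; first apply: cvgB; try apply: cvgM; try exact: cvg_cst; exact: cp.
Unshelve. all: by end_near. Qed.

Lemma pospart_npos (t : R) : t <= 0 -> pospart t = 0.
Proof. by move=> h; rewrite /pospart max_r. Qed.

Lemma pospart_nneg (t : R) : 0 <= t -> pospart t = t.
Proof. by move=> h; rewrite /pospart max_l. Qed.

Lemma chi_eq1 (t : R) : t <= 1 -> chi t = 1.
Proof. by move=> h; rewrite /chi !pospart_npos; lra. Qed.

Lemma dchi_le1 (t : R) : t <= 1 -> dchi t = 0.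
Proof. by move=> h; rewrite /dchi !pospart_npos; lra. Qed.

Lemma chi_eq0 (t : R) : 4 <= t -> chi t = 0.
Proof. by move=> h; rewrite /chi !pospart_nneg; [field|lra..]. Qed.

Lemma dchi_ge4 (t : R) : 4 <= t -> dchi t = 0.
Proof. by move=> h; rewrite /dchi !pospart_nneg; [field|lra..]. Qed.

Lemma dchi_le0 (t : R) : dchi t <= 0.
Proof.
have [h4|h4] := leP 4 t; first by rewrite dchi_ge4.
have [h1|h1] := leP t 1; first by rewrite dchi_le1.
rewrite /dchi (@pospart_nneg (t - 1)); last lra; rewrite (@pospart_npos (t - 4)); last lra.
by case: (pospartE (t - 2)) => -[? ->]; case: (pospartE (t - 3)) => -[? ->]; nra.
Qed.

Lemma chi_ge0 (t : R) : 0 <= chi t.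
Proof.
have [h4|h4] := leP 4 t; first by rewrite chi_eq0.
have [h1|h1] := leP t 1; first by rewrite chi_eq1.
rewrite /chi (@pospart_nneg (t - 1)); last lra; rewrite (@pospart_npos (t - 4)); last lra.
(* Between 3 and 4 the cutoff equals [(4 - t) ^+ 3 / 6]. *)
have h3 : 0 <= (4 - t) ^+ 3 by rewrite exprn_ge0// subr_ge0 ltW.
case: (pospartE (t - 3)) => -[? ->]; last first.
  by rewrite (@pospart_nneg (t - 2)); last lra; lra.
case: (pospartE (t - 2)) => -[? ->]; last first.
  have : 0 <= (t - 2) ^+ 3 by rewrite exprn_ge0.
  have : 0 <= (3 - t) * (t - 2) ^+ 2 by rewrite mulr_ge0 ?sqr_ge0//; lra.
  by nra.
have : (t - 1) ^+ 3 <= 1 by rewrite exprn_ile1; lra.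
by nra.
Qed.

End Cutoff.

(** * Bumps built from quadratic functions *)

Section Bump.
Variables (R : realType) (J : nat).
Notation vec := 'rV[R]_J.
Implicit Types (m u w x y z : vec).

Definition quadr m (a : R) u : R := dotv m u + a * dotv u u.

Lemma is_pd_quadr m a i u : is_derive u (evec R i) (quadr m a) ((m + (2 * a) *: u) 0 i).
Proof.
apply/is_derive_line0.
have de (w : vec) : dotv w (evec R i) = w 0 i.
  rewrite /dotv (bigD1 i)//= mxE !eqxx mulr1 big1 ?addr0// => j ji.
  by rewrite mxE (negbTE ji) andbF mulr0.
have dd : dotv (evec R i) (evec R i) = 1 by rewrite de mxE !eqxx.
have dl : is_derive (0 : R) (1 : R) (fun s : R => dotv m (u + s *: evec R i)) (m 0 i).
  apply: is_derive_quadratic_error => h.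
  rewrite addr0 scale0r addr0 dotvDr dotvZr de.
  rewrite (_ : _ - _ = 0) ?normr0 ?sqr_ge0//; ring.
have dq : is_derive (0 : R) (1 : R)
    (fun s : R => dotv (u + s *: evec R i) (u + s *: evec R i)) (2 * u 0 i).
  apply: is_derive_quadratic_error => h.
  rewrite addr0 scale0r addr0 !dotvDl !dotvDr !dotvZl !dotvZr dd (dotvC (evec R i)) de.
  by rewrite ler_norml; nra.
apply: (is_derive_eq (is_deriveD dl (is_deriveM (is_derive_cst a _ _) dq))).
by rewrite /GRing.scale/= !mxE; ring.
Qed.

Lemma C2_quadr m a : C2 (quadr m a).
Proof.
apply: (C2_of (is_pd_quadr m a)) => i; under eq_fun do rewrite !mxE.
apply: C1D; first exact: C1_cst.
by apply: C1M; [exact: C1_cst|exact: (C2_coord _ _).1].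
Qed.

Lemma pd_quadr m a i u : pd i (quadr m a) u = (m + (2 * a) *: u) 0 i.
Proof. by have h := is_pd_quadr m a i u; exact: derive_val. Qed.

(** The first factor is the bump proper. The second, used with [c = 4 / r ^+ 2], is 1 up to radius
    [r / 2] and 0 from radius [r] on; it gives compact support also outside the closure of [G],
    where [quadr m a] is not controlled. *)
Definition profile m (a c : R) u : R := chi (quadr m a u) * chi (quadr 0 c u).

Lemma C2_chi_quadr m a : C2 (fun u => chi (quadr m a u)).
Proof.
apply: (C2_comp (@is_derive_chi R) (@is_derive_dchi R) (@ddchi_continuous R)).
exact: C2_quadr.
Qed.

Lemma C2_profile m a c : C2 (profile m a c).
Proof. by apply: C2M; exact: C2_chi_quadr. Qed.

Lemma pd_profile m a c i u : pd i (profile m a c) u =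
  chi (quadr m a u) * (dchi (quadr 0 c u) * (2 * c * u 0 i)) +
  chi (quadr 0 c u) * (dchi (quadr m a u) * (m + (2 * a) *: u) 0 i).
Proof.
have pc m' a' : pd i (fun u => chi (quadr m' a' u)) u =
    dchi (quadr m' a' u) * (m' + (2 * a') *: u) 0 i.
  have h := is_pd_comp i u (@is_derive_chi R) (C2_quadr m' a').1.
  by rewrite -pd_quadr; exact: derive_val.
have h := is_pdM i u (C2_chi_quadr m a).1 (C2_chi_quadr 0 c).1.
rewrite {1}/pd (derive_val (f := profile m a c)) !pc.
by congr (_ * (_ * _) + _); rewrite !mxE add0r.
Qed.

Lemma dotv_grad_profile m a c d u : dotv d (grad (profile m a c) u) =
  chi (quadr m a u) * dchi (quadr 0 c u) * (2 * c) * dotv d u +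
  chi (quadr 0 c u) * dchi (quadr m a u) * dotv d (m + (2 * a) *: u).
Proof.
rewrite /dotv !mulr_sumr -big_split/=; apply: eq_bigr => i _.
by rewrite [grad _ _ _ _]mxE pd_profile; ring.
Qed.

Lemma quadr0E c u : quadr 0 c u = c * enorm u ^+ 2.
Proof. by rewrite /quadr dotv0l add0r enorm_sqr. Qed.

Lemma profile_far m a (r : R) u : 0 < r -> r <= enorm u -> profile m a (4 / r ^+ 2) u = 0.
Proof.
move=> r0 ru; rewrite /profile [chi (quadr 0 _ _)]chi_eq0 ?mulr0// quadr0E.
rewrite mulrAC ler_pdivlMr ?exprn_gt0// ler_pM2l//.
by rewrite ler_sqr ?nnegrE ?enorm_ge0// ltW.
Qed.

Lemma cutoff_arg_le1 (r : R) u : 0 < r -> enorm u <= r / 2 -> quadr 0 (4 / r ^+ 2) u <= 1.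
Proof.
move=> r0 ru; rewrite quadr0E mulrAC ler_pdivrMr ?exprn_gt0// mul1r.
by have := enorm_ge0 u; nra.
Qed.

Lemma profile_near m a (r : R) u : 0 < r -> enorm u <= r / 2 -> quadr m a u <= 1 ->
  profile m a (4 / r ^+ 2) u = 1.
Proof.
by move=> r0 ru qu; rewrite /profile !chi_eq1 ?mulr1// cutoff_arg_le1.
Qed.

Lemma quadr_le m (a kap : R) u : 0 <= a -> enorm u <= kap ->
  enorm m * kap + a * kap ^+ 2 <= 1 -> quadr m a u <= 1.
Proof.
move=> a0 uk; apply: le_trans; rewrite /quadr -enorm_sqr; apply: lerD.
  apply: le_trans (dotv_le _ _) _; rewrite ler_wpM2l ?enorm_ge0//.
by rewrite ler_wpM2l// ler_sqr ?nnegrE ?enorm_ge0// (le_trans (enorm_ge0 u)).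
Qed.

Variables (I : finType) (phi : I -> vec -> R) (gamma : I -> vec -> vec) (V : set vec).

Definition local_bump (eps B tau : R) y (g : vec -> R) :=
  [/\ Hclass phi gamma V g /\ C2c phi g, forall w, 0 <= g w,
      forall w, eps < enorm (w - y) -> g w = 0, C2_bounded_by g B &
      forall w, Gbar phi w -> enorm (w - y) <= tau -> 1 <= g w].

(** [B] and [tau] are chosen before the point of [A]. The property passes to subsets and finite
    unions, so it can be proved piece by piece. *)
Definition unif_bumps (eps : R) (A : set vec) :=
  exists B tau : R, 0 < tau /\ forall y, A y -> exists g, local_bump eps B tau y g.

Lemma unif_bumps_sub eps A A' : A' `<=` A -> unif_bumps eps A -> unif_bumps eps A'.
Proof. by move=> s [B [tau [t0 h]]]; exists B, tau; split=> // y /s /h. Qed.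

Lemma unif_bumps_set0 eps : unif_bumps eps set0.
Proof. by exists 0, 1; split. Qed.

Lemma unif_bumpsU eps A A' : unif_bumps eps A -> unif_bumps eps A' ->
  unif_bumps eps (A `|` A').
Proof.
move=> [B [tau [t0 h]]] [B' [tau' [t'0 h']]].
exists (Num.max B B'), (Num.min tau tau'); split; first by rewrite lt_min t0.
move=> y [/h|/h'] [g [h1 h2 h3 h4 h5]]; exists g; split=> //.
- by apply: C2_bounded_by_le h4; rewrite le_max lexx.
- by move=> w Gw; rewrite le_min => /andP[? ?]; exact: h5.
- by apply: C2_bounded_by_le h4; rewrite le_max lexx orbT.
- by move=> w Gw; rewrite le_min => /andP[? ?]; exact: h5.
Qed.

Lemma unif_bumps_bigU eps (T : eqType) (s : seq T) (A : T -> set vec) :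
  (forall k, k \in s -> unif_bumps eps (A k)) ->
  unif_bumps eps [set y | exists2 k, k \in s & A k y].
Proof.
elim: s => [|k s IH] h.
  by apply: unif_bumps_sub (unif_bumps_set0 eps) => y [].
apply: unif_bumps_sub (unif_bumpsU (h k (mem_head _ _)) (IH _)).
  move=> y [l]; rewrite inE => /orP[/eqP->|ls] Ay; first by left.
  by right; exists l.
by move=> l ls; apply: h; rewrite inE ls orbT.
Qed.

(** The first condition makes [chi (quadr m a _)] vanish on the shell where the radial factor of
    [profile] varies; the second gives the sign of the gradient along the reflection directions; the
    third makes the bump constant near each point of [V]. *)
Definition admissible m (a r : R) z :=
  [/\ forall y, Gbar phi y -> r / 2 < enorm (y - z) -> enorm (y - z) <= r ->
        4 <= quadr m a (y - z),
      forall y i, Gbar phi y -> enorm (y - z) <= r / 2 -> phi i y = 0 ->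
        0 <= dotv (gamma i y) (m + (2 * a) *: (y - z)) &
      forall w, V w -> w = z \/ 2 * r <= enorm (w - z)].

(** On the shell the first factor and its derivative vanish, and beyond [r] the second factor and
    its derivative do. On the inner ball the second factor has zero derivative, and the sign comes
    from [dchi] being nonpositive. *)
Lemma grad_profile_le0 m a r z y d : 0 < r -> admissible m a r z -> bdG phi y ->
  dcone phi gamma y d -> dotv d (grad (profile m a (4 / r ^+ 2)) (y - z)) <= 0.
Proof.
move=> r0 [ha hb _] [Gy _] dd; rewrite dotv_grad_profile.
set c := 4 / r ^+ 2.
have [yz|yz] := leP (enorm (y - z)) (r / 2); last first.
  have [yr|yr] := leP (enorm (y - z)) r.
    have h4 := ha _ Gy yz yr.
    by rewrite [chi (quadr m a _)]chi_eq0// [dchi (quadr m a _)]dchi_ge4// mulr0 !mul0r addr0.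
  have h4 : 4 <= quadr 0 c (y - z).
    rewrite quadr0E mulrAC ler_pdivlMr ?exprn_gt0// ler_pM2l//.
    by rewrite ler_sqr ?nnegrE ?enorm_ge0// ltW.
  by rewrite [dchi (quadr 0 c _)]dchi_ge4// [chi (quadr 0 c _)]chi_eq0// mulr0 !mul0r addr0.
rewrite [dchi (quadr 0 c _)]dchi_le1 ?cutoff_arg_le1// mulr0 !mul0r add0r.
rewrite mulr_le0_ge0//; first by rewrite mulr_ge0_le0 ?chi_ge0 ?dchi_le0.
case: dd => [[_ [s [s0 ->]]]|[_ ->]]; last by rewrite dotv0l.
rewrite dotv_suml; apply: sumr_ge0 => i /asboolP iy.
by rewrite dotvZl mulr_ge0// hb.
Qed.

(** All these bumps are translates of one function, so one C2 bound serves every centre. A bump is 1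
    within [kap] of [z], hence within [kap / 2] of any [y] that is [kap / 2]-close to [z]. *)
Lemma unif_bumps_profile m (a r kap eps : R) :
  0 < r -> 0 <= a -> 0 < kap -> kap <= r / 2 ->
  enorm m * kap + a * kap ^+ 2 <= 1 -> 2 * r <= eps ->
  unif_bumps eps [set y | exists2 z, admissible m a r z & enorm (y - z) <= kap / 2].
Proof.
move=> r0 a0 k0 kr mk re.
have [B hB] : exists B : R, C2_bounded_by (profile m a (4 / r ^+ 2)) B.
  apply: (@C2_support_bounded _ _ _ 0 r) => [|y]; first exact: C2_profile.
  by rewrite subr0; exact: profile_far.
exists B, (kap / 2); split; first by lra.
move=> y [z adm yz]; have [ha hb hV] := adm.
have [g2 [gpd gpd2]] := C2_translate z (C2_profile m a (4 / r ^+ 2)).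
exists (fun w => profile m a (4 / r ^+ 2) (w - z)).
have g1 w : enorm (w - z) <= kap -> profile m a (4 / r ^+ 2) (w - z) = 1.
  move=> wz; apply: profile_near => //; first by lra.
  exact: quadr_le wz mk.
have gsupp w : ~ eball z r w -> profile m a (4 / r ^+ 2) (w - z) = 0.
  by move=> wz; apply: profile_far => //; rewrite leNgt; apply/negP => /ltW.
split.
- have cr := @compact_eball R J z r.
  split; last by split=> //; exists (eball z r); split=> // w _; exact: gsupp.
  split; first by split=> //; exists 0, (eball z r); split=> // w _; exact: gsupp.
  split; last first.
    move=> w d bw dw; rewrite (_ : grad _ _ = grad (profile m a (4 / r ^+ 2)) (w - z)).
      exact: grad_profile_le0 dw.
    by apply/rowP => i; rewrite !mxE gpd.
  move=> w /hV[->|wz].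
    by exists kap => // w1 w2 _ _ h1 h2; rewrite !g1.
  exists r => // w1 w2 _ _ h1 h2.
  have g0 w' : eball w r w' -> profile m a (4 / r ^+ 2) (w' - z) = 0.
    move=> h; rewrite profile_far//; rewrite /eball/= in h.
    by have := ler_edistD w' w z; rewrite (enorm_distC w w'); lra.
  by rewrite !g0.
- by move=> w; rewrite mulr_ge0 ?chi_ge0.
- move=> w wy; apply: profile_far => //.
  by have := ler_edistD z w y; rewrite (enorm_distC z y); lra.
- move=> w; have [h1 [h2 h3]] := hB (w - z).
  split; first exact: h1.
  by split=> [i|i j]; [rewrite gpd; exact: h2|rewrite gpd2; exact: h3].
- move=> w _ wy; rewrite g1//.
  by have := ler_edistD y w z; lra.
Qed.

(* The standard choice of parameters: the linear part pushes along [n], which is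
   strictly positive on the reflection directions, and the quadratic part is
   small enough at scale [r] not to spoil this, yet localizes at scale [r]. *)
Lemma admissible_cone n (th r : R) z : 0 < th -> 0 < r ->
  (forall y i, Gbar phi y -> enorm (y - z) <= r -> phi i y = 0 ->
     th * enorm (gamma i y) <= dotv n (gamma i y)) ->
  (forall y, Gbar phi y -> enorm (y - z) <= r -> - (th / 8 * r) <= dotv n (y - z)) ->
  (forall w, V w -> w = z \/ 2 * r <= enorm (w - z)) ->
  admissible ((32 / (th * r)) *: n) (32 / r ^+ 2) r z.
Proof.
move=> t0 r0 hg hn hV.
have s0 : 0 < 32 / (th * r) by rewrite divr_gt0 ?mulr_gt0.
have rne : r != 0 by rewrite gt_eqF.
have tne : th != 0 by rewrite gt_eqF.
split=> // [y Gy yz yr|y i Gy yz py].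
  (* The linear part is at least -4 and the quadratic part at least 8. *)
  rewrite /quadr dotvZl -enorm_sqr.
  have h1 : 32 / (th * r) * - (th / 8 * r) <= 32 / (th * r) * dotv n (y - z).
    by rewrite ler_pM2l// hn.
  have h2 : 32 / r ^+ 2 * (r / 2) ^+ 2 <= 32 / r ^+ 2 * enorm (y - z) ^+ 2.
    rewrite ler_pM2l ?divr_gt0 ?exprn_gt0// ler_sqr ?nnegrE ?enorm_ge0//; last lra.
    exact: ltW.
  have E1 : 32 / (th * r) * - (th / 8 * r) = - 4 by field; rewrite rne.
  have E2 : 32 / r ^+ 2 * (r / 2) ^+ 2 = 8 by field.
  by lra.
(* Up to the factor [32 / (th * r)] the gradient is [n + (2 * th / r) *: (y - z)]; on the inner ball
   its second term costs at most [th * enorm (gamma i y)]. *)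
have -> : 2 * (32 / r ^+ 2) = 32 / (th * r) * (2 * th / r) by field; rewrite rne.
rewrite -[(_ * _) *: (y - z)]scalerA -scalerDr dotvZr mulr_ge0 ?(ltW s0)//.
rewrite dotvDr dotvZr dotvC.
have h1 : th * enorm (gamma i y) <= dotv n (gamma i y) by apply: hg => //; lra.
have h2 := dotv_leN (gamma i y) (y - z).
have h3 : enorm (gamma i y) * enorm (y - z) <= enorm (gamma i y) * (r / 2).
  by rewrite ler_wpM2l ?enorm_ge0.
have h4 : 2 * th / r * - (enorm (gamma i y) * (r / 2)) <=
    2 * th / r * dotv (gamma i y) (y - z).
  by rewrite ler_pM2l ?divr_gt0 ?mulr_gt0//; lra.
have E : 2 * th / r * - (enorm (gamma i y) * (r / 2)) = - (th * enorm (gamma i y)).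
  by field.
by lra.
Qed.

(** With [kap = lam * r] the smallness condition of [unif_bumps_profile] no longer involves [r], so
    [lam] can be fixed before the scale. *)
Lemma unif_bumps_cone n (th r eps lam : R) : 0 < th -> 0 < r -> 2 * r <= eps ->
  0 < lam -> lam * (32 * (enorm n / th + 1)) <= 1 ->
  unif_bumps eps [set y | exists2 z,
    admissible ((32 / (th * r)) *: n) (32 / r ^+ 2) r z & enorm (y - z) <= lam * r / 2].
Proof.
move=> t0 r0 re l0 hl.
have rne : r != 0 by rewrite gt_eqF.
have tne : th != 0 by rewrite gt_eqF.
have nt : 0 <= enorm n / th by rewrite divr_ge0 ?enorm_ge0// ltW.
have l1 : 32 * lam <= 1 by nra.
apply: unif_bumps_profile => //.
- by rewrite divr_ge0 ?exprn_ge0// ltW.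
- by rewrite mulr_gt0.
- by nra.
rewrite enormZ ger0_norm; last by rewrite divr_ge0 ?mulr_ge0// ltW.
have -> : 32 / (th * r) * enorm n * (lam * r) + 32 / r ^+ 2 * (lam * r) ^+ 2 =
    lam * (32 * (enorm n / th)) + 32 * lam ^+ 2 by field; rewrite ?rne ?tne.
by nra.
Qed.

End Bump.

(** * Locally finite sums *)

Section LocallyFinite.
Variables (R : realType) (J : nat).
Notation vec := 'rV[R]_J.

Lemma sum_support_eq (s t : seq nat) (F : nat -> R) : uniq s -> uniq t ->
  (forall k, k \notin s -> F k = 0) -> (forall k, k \notin t -> F k = 0) ->
  \sum_(k <- s) F k = \sum_(k <- t) F k.
Proof.
move=> us ut hs ht.
rewrite -(@big_rmcond _ _ _ _ s (mem t) F ht) -(@big_rmcond _ _ _ _ t (mem s) F hs).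
rewrite -big_filter -[RHS]big_filter; apply: perm_big; apply: uniq_perm.
- exact: filter_uniq.
- exact: filter_uniq.
- by move=> k; rewrite !mem_filter /= andbC.
Qed.

Lemma norm_sum_le (s : seq nat) (F : nat -> R) (B : R) (M : nat) :
  (forall k, `|F k| <= B) -> (size s <= M)%N -> `|\sum_(k <- s) F k| <= M%:R * B.
Proof.
move=> hF sM; have B0 : 0 <= B by exact: le_trans (normr_ge0 _) (hF 0%N).
apply: (@le_trans _ _ ((size s)%:R * B)); last by rewrite ler_wpM2r// ler_nat.
elim: s {sM} => [|k s IH]; first by rewrite big_nil normr0 mul0r.
rewrite big_cons -natr1 mulrDl mul1r addrC.
by apply: le_trans (ler_normD _ _) _; rewrite lerD.
Qed.

Lemma pd_sum (s : seq nat) (F : nat -> vec -> R) i : (forall k, C1 (F k)) ->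
  pd i (fun y => \sum_(k <- s) F k y) = fun y => \sum_(k <- s) pd i (F k) y.
Proof.
move=> hF; apply/funext => y.
suff h : is_derive y (evec R i) (fun y => \sum_(k <- s) F k y) (\sum_(k <- s) pd i (F k) y).
  exact: derive_val.
elim: s => [|k s IH].
  by rewrite big_nil; under eq_fun do rewrite big_nil; exact: is_derive_cst.
rewrite big_cons; under eq_fun do rewrite big_cons.
by apply: is_deriveD => //; exact: C1_is_derive.
Qed.

Definition locally_supported (S : vec -> seq nat) (g : nat -> vec -> R) :=
  forall x, exists2 r : R, 0 < r &
    forall y k, enorm (y - x) <= r -> k \notin S x -> g k y = 0.

Variables (S : vec -> seq nat) (g : nat -> vec -> R).
Hypotheses (uS : forall x, uniq (S x)) (lS : locally_supported S g).

Let f y : R := \sum_(k <- S y) g k y.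

Lemma locally_supported_at y k : k \notin S y -> g k y = 0.
Proof. by have [r r0 h] := lS y; apply: h; rewrite subrr enorm0 ltW. Qed.

(** The index sequence in [f] varies with the point; near [x] it may be replaced by the fixed [S x],
    since indices outside either sequence contribute zero. *)
Lemma locfin_near x : \forall y \near x, f y = \sum_(k <- S x) g k y.
Proof.
have [r r0 h] := lS x; apply/nbhs_enormP; exists r => // y yx.
apply: sum_support_eq => // k; first exact: locally_supported_at.
exact: h.
Qed.

Lemma locfin_cvg y : (fun m => \sum_(0 <= k < m) g k y) @ \oo --> f y.
Proof.
apply: cvg_near_cst; near=> m.
apply: sum_support_eq => //; first exact: iota_uniq.
  move=> k; rewrite mem_index_iota /= -leqNgt => mk.
  apply: locally_supported_at; apply/negP => kS.
  have km : (k < m)%N.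
    apply: (@leq_trans (\max_(j <- S y) j).+1).
      by rewrite ltnS; apply: leq_bigmax_seq.
    by near: m; exact: nbhs_infty_ge.
  by rewrite ltnNge mk in km.
exact: locally_supported_at.
Unshelve. all: by end_near. Qed.

Lemma C2_locfin : (forall k, C2 (g k)) -> C2 f.
Proof.
move=> g2; apply: C2_local => x; exists (fun y => \sum_(k <- S x) g k y).
  exact: C2_sum.
exact: locfin_near.
Qed.

Lemma locfin_bounded (B : R) (M : nat) : (forall k, C2 (g k)) ->
  (forall k, C2_bounded_by (g k) B) -> (forall x, (size (S x) <= M)%N) ->
  C2_bounded_by f (M%:R * B).
Proof.
move=> g2 gB SM y; split; last split=> [i|i j].
- by apply: norm_sum_le => // k; have [] := gB k y.
- rewrite (nbhs_singleton (near_eq_pd i (locfin_near y))) pd_sum; last by move=> k; case: (g2 k).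
  by apply: norm_sum_le => // k; have [_ []] := gB k y.
- rewrite (nbhs_singleton (near_eq_pd j (near_eq_pd i (locfin_near y)))).
  rewrite pd_sum; last by move=> k; case: (g2 k).
  rewrite pd_sum; last by move=> k; case: (g2 k) => _; exact.
  by apply: norm_sum_le => // k; have [_ []] := gB k y.
Qed.

End LocallyFinite.

(** * Grid selection of bumps and the functions of Assumption TF *)

Section Cover.
Variables (R : realType) (J : nat).
Notation vec := 'rV[R]_J.
Variables (I : finType) (phi : I -> vec -> R) (gamma : I -> vec -> vec) (V : set vec).

Lemma pd_cst (a : R) i : pd i (fun _ : vec => a) = fun _ => 0.
Proof. by apply/funext => x; rewrite /pd derive_cst. Qed.

Lemma Hclass_zero : Hclass phi gamma V (fun _ => 0) /\ C2c phi (fun _ : vec => 0).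
Proof.
split; last by split; [exact: C2_cst|exists set0; split=> //; exact: compact0].
split; first by split; [exact: C2_cst|exists 0, set0; split=> //; exact: compact0].
split=> [x _|y d _ _]; first by exists 1.
rewrite (_ : grad _ _ = 0) ?dotv0r//.
by apply/rowP => i; rewrite !mxE pd_cst.
Qed.

Lemma C2_bounded_by_zero (B : R) : 0 <= B -> C2_bounded_by (fun _ : vec => 0) B.
Proof.
by move=> B0 y; split; [|split=> [i|i j]]; rewrite ?pd_cst normr0.
Qed.

Definition cell (h : R) (y : vec) : 'rV[int]_J := \row_i Num.floor (y 0 i / h).

Lemma cell_eq_dist h y w : 0 < h -> cell h y = cell h w -> enorm (y - w) <= J%:R * h.
Proof.
move=> h0 /rowP E; apply: enorm_le_sum; last exact: ltW.
move=> i; have := E i; rewrite !mxE => Ei.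
have /andP[a1 a2] := floor_itv (y 0 i / h); have /andP[b1 b2] := floor_itv (w 0 i / h).
rewrite Ei in a1 a2; rewrite intrD in a2 b2.
have e : `|y 0 i / h - w 0 i / h| <= 1.
  by rewrite ler_norml; lra.
by move: e; rewrite -mulrBl normrM normfV (gtr0_norm h0) ler_pdivrMr// mul1r.
Qed.

Lemma floor_dist (a b : R) (D : nat) : `|a - b| + 1 <= D%:R ->
  (`|Num.floor a - Num.floor b| <= D)%N.
Proof.
have /andP[a1 a2] := floor_itv a; have /andP[b1 b2] := floor_itv b.
rewrite intrD in a2 b2 => hD.
have : `|(Num.floor a - Num.floor b)%:~R| <= D%:R :> R.
  apply: le_trans hD; rewrite intrB.
  have := ler_norm (a - b); have := ler_norm (b - a); rewrite (distrC b a).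
  by rewrite ler_norml; lra.
by rewrite -intr_norm -abszE -pmulrn ler_nat.
Qed.

(** Codes of the cells at sup distance at most [D] from [q]. Indexing them by finite functions
    bounds their number independently of [q]. *)
Definition cell_box (D : nat) (q : 'rV[int]_J) : seq nat :=
  undup [seq pickle (q + \row_i ((k i : nat)%:Z - D%:Z)) | k : {ffun 'I_J -> 'I_(2 * D).+1}].

Lemma size_cell_box D q : (size (cell_box D q) <= #|{ffun 'I_J -> 'I_(2 * D).+1}|)%N.
Proof. by rewrite (leq_trans (size_undup _))// size_map -cardE. Qed.

Lemma mem_cell_box D (q q' : 'rV[int]_J) : (forall i, `|q' 0%R i - q 0%R i| <= D)%N ->
  pickle q' \in cell_box D q.
Proof.
move=> h; rewrite mem_undup; apply/mapP.
exists [ffun i => inord (absz (q' 0 i - q 0 i + D%:Z))]; first by rewrite mem_enum.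
congr pickle; apply/rowP => i; rewrite !mxE ffunE.
have {h} := h i; move: (q' 0 i) (q 0 i) => c a hD.
have hlt : (absz (c - a + D%:Z)%R < (2 * D).+1)%N by lia.
by rewrite inordK//; lia.
Qed.

(** Each grid cell meeting the closure of [G] gets one bump, centred at a chosen point of the cell.
    Cells have diameter at most [tau], so the bump is at least 1 on the part of its cell in that
    closure; distinct bumps have centres in distinct cells, which bounds the overlap. *)
Lemma bump_cover (eps : R) : 0 < eps -> unif_bumps phi gamma V eps (Gbar phi) ->
  exists (p : nat -> vec) (g : nat -> vec -> R) (B : R) (M : nat) (S : vec -> seq nat),
  [/\ forall k, Hclass phi gamma V (g k) /\ C2c phi (g k),
      forall k w, 0 <= g k w /\ (eps < enorm (w - p k) -> g k w = 0),
      forall k, C2_bounded_by (g k) B,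
      forall y, Gbar phi y -> exists k, 1 <= g k y &
      (forall x, uniq (S x) /\ (size (S x) <= M)%N) /\ locally_supported S g].
Proof.
move=> e0 [B0 [tau [t0 hb]]].
pose B := Num.max B0 0.
pose h := tau / (J%:R + 1).
have J0 : 0 < J%:R + 1 :> R by rewrite ltr_wpDl.
have h0 : 0 < h by rewrite divr_gt0.
have Jh : J%:R * h <= tau.
  by rewrite /h mulrA ler_pdivrMr// mulrC ler_pM2l// lerDl.
(* A cell without points of the closure of [G] gets the zero function. *)
have /choice[P hP] (q : 'rV[int]_J) : exists pg : vec * (vec -> R),
    (cell h pg.1 = q /\ local_bump phi gamma V eps B tau pg.1 pg.2) \/
    ((forall y, Gbar phi y -> cell h y <> q) /\ pg.2 = fun _ => 0).
  have [[y Gy yq]|ne] := pselect (exists2 y, Gbar phi y & cell h y = q).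
    have [g [h1 h2 h3 h4 h5]] := hb _ Gy; exists (y, g); left; split=> //=; split=> //.
    by apply: C2_bounded_by_le h4; rewrite le_max lexx.
  by exists (0, fun _ => 0); right; split=> // y Gy yq; apply: ne; exists y.
have zero := Hclass_zero.
(* Cells are numbered by [pickle]; a number that encodes no cell gets the zero function. *)
pose p k := if pickle_inv k is Some q then (P q).1 else 0.
pose g k := if pickle_inv k is Some q then (P q).2 else fun _ => 0.
(* A bump that is nonzero within [h] of [x] has its centre within [eps + h] of [x]; rounding down to
   cell indices adds at most 1. *)
pose D := Num.bound ((eps + h) / h + 1).
exists p, g, B, #|{ffun 'I_J -> 'I_(2 * D).+1}|, (fun x => cell_box D (cell h x)).
have gsupp k w : eps < enorm (w - p k) -> g k w = 0.
  rewrite /g /p; case: pickle_inv => // q.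
  by have [[_ [_ _ h3 _ _]]|[_ ->]] := hP q => //; exact: h3.
split.
- move=> k; rewrite /g; case: pickle_inv => [q|//].
  by have [[_ [h1 _ _ _ _]]|[_ ->]] := hP q.
- move=> k w; split; last exact: gsupp.
  rewrite /g; case: pickle_inv => [q|//].
  by have [[_ [_ h2 _ _ _]]|[_ ->]] := hP q.
- have z : C2_bounded_by (fun _ : vec => 0) B.
    by apply: C2_bounded_by_zero; rewrite le_max lexx orbT.
  move=> k; rewrite /g; case: pickle_inv => [q|//].
  by have [[_ [_ _ _ h4 _]]|[_ ->]] := hP q.
- move=> y Gy; exists (pickle (cell h y)); rewrite /g pickleK_inv.
  have [[yq [_ _ _ _ h5]]|[/(_ _ Gy)//]] := hP (cell h y).
  by apply: h5 => //; apply: le_trans Jh; exact: cell_eq_dist.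
- split=> [x|x]; first by rewrite undup_uniq size_cell_box.
  exists h => // y k yx; apply: contraNeq => gky.
  have := gky; rewrite {1}/g; have := @pickle_invK 'rV[int]_J k.
  case E : (pickle_inv k) => [q|]; last by rewrite eqxx.
  move=> /= <- Pq; have [[cq _]|[_ P0]] := hP q; last by rewrite P0 eqxx in Pq.
  rewrite -cq; apply: mem_cell_box => i; rewrite !mxE; apply: floor_dist.
  have py : enorm (y - p k) <= eps.
    by rewrite leNgt; apply/negP => /gsupp /eqP; rewrite (negbTE gky).
  rewrite /p E in py.
  have px : enorm ((P q).1 - x) <= eps + h.
    by have := ler_edistD y (P q).1 x; rewrite (enorm_distC _ y); lra.
  have := le_trans (enorm_coord _ i) px; rewrite !mxE => pxi.
  apply: (@le_trans _ _ ((eps + h) / h + 1)); last first.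
    by apply/ltW/archi_boundP; rewrite addr_ge0// divr_ge0 ?addr_ge0// ltW.
  rewrite lerD2r -mulrBl normrM normfV (gtr0_norm h0).
  by rewrite ler_pM2r ?invr_gt0.
Qed.

(** The function for [x] sums the bumps, of radius [eps / 2], whose centres are farther than
    [2 * eps] from [x]; these vanish within [eps / 2] of [x]. A point farther than [3 * eps] lies
    within [eps / 2] of the centre of a bump that is at least 1 there, and this bump is kept. The C2
    bound is common to all [x]. *)
Lemma TF_of_unif_bumps (N : nat) (b : vec -> vec) (sigma : vec -> 'M[R]_(J, N)) :
  (exists M : R, forall x, enorm (b x) <= M /\ forall i j, `|sigma x i j| <= M) ->
  (forall eps : R, 0 < eps -> unif_bumps phi gamma V eps (Gbar phi)) ->
  AssumptionTF phi gamma b sigma V.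
Proof.
move=> [Mc hMc] hub eps n e0.
have e20 : 0 < eps / 2 by lra.
have [p [g [B [M [S [gH gs gB gc [hS lS]]]]]]] := bump_cover e20 (hub _ e20).
pose gx (x : vec) k : vec -> R := if 2 * eps < enorm (p k - x) then g k else fun _ => 0.
pose f x y : R := \sum_(k <- S y) gx x k y.
have Mc0 : 0 <= Mc by exact: le_trans (enorm_ge0 _) (hMc 0).1.
have B0 : 0 <= B by exact: le_trans (normr_ge0 _) (gB 0%N 0).1.
pose Bf : R := M%:R * B.
have Bf0 : 0 <= Bf by rewrite mulr_ge0.
(* Drift part plus diffusion part, with entries of [a] at most [N%:R * (Mc * Mc)]; the final 1 makes
   [C] positive. *)
pose C : R := J%:R * (Mc * Bf) + 2^-1 * (J%:R * (J%:R * ((N%:R * (Mc * Mc)) * Bf))) + 1.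
exists f, C, 2^-1; split.
  by rewrite /C ltr_wpDl// !(addr_ge0, mulr_ge0).
split; first by rewrite invr_gt0.
move=> x Gx _.
have uS y : uniq (S y) by case: (hS y).
have lx : locally_supported S (gx x).
  move=> y; have [r r0 h] := lS y; exists r => // w k wy kS.
  by rewrite /gx; case: ifP => // _; exact: h kS.
have gxH k : Hclass phi gamma V (gx x k) /\ C2c phi (gx x k).
  by rewrite /gx; case: ifP => // _; exact: Hclass_zero.
have gx2 k : C2 (gx x k) by have [_ []] := gxH k.
have gxB k : C2_bounded_by (gx x k) B.
  by rewrite /gx; case: ifP => // _; exact: C2_bounded_by_zero.
have gx0 k y : 0 <= gx x k y.
  by rewrite /gx; case: ifP => // _; case: (gs k y).
have fB : C2_bounded_by (f x) Bf.
  by apply: locfin_bounded => // y; case: (hS y).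
split.
- by move=> y _; apply: sumr_ge0.
- split; first exact: C2_locfin.
  by exists Bf => y _; exact: fB.
- by exists (gx x); split=> // y _; exact: locfin_cvg.
- split=> y Gy yx.
    rewrite /f big1// => k _; rewrite /gx; case: ifP => // pk.
    apply: (gs k y).2; have := ler_edistD y (p k) x; rewrite (enorm_distC _ y).
    by lra.
  have [k gk] := gc _ Gy.
  have yp : enorm (y - p k) <= eps / 2.
    by rewrite leNgt; apply/negP => /(gs k y).2 E; rewrite E ler10 in gk.
  have gxk : gx x k = g k.
    rewrite /gx ifT//; have := ler_edistD (p k) y x.
    by lra.
  have kS : k \in S y.
    apply: contraT => kS; move: gk; rewrite (locally_supported_at lS kS) ler10.
    by [].
  rewrite /f (big_rem k kS)/= gxk.
  have : 0 <= \sum_(j <- rem k (S y)) gx x j y by apply: sumr_ge0.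
  by lra.
- move=> y Gy; have [_ [f1 f2]] := fB y.
  have cb (F : 'I_J -> R) (K : R) : (forall i, `|F i| <= K) -> `|\sum_i F i| <= J%:R * K.
    move=> hF; apply: le_trans (ler_norm_sum _ _ _) _.
    apply: le_trans (ler_sum _ (fun i _ => hF i)) _.
    by rewrite sumr_const card_ord mulr_natl.
  have t1 : `|\sum_(i < J) b y 0 i * pd i (f x) y| <= J%:R * (Mc * Bf).
    apply: cb => i; rewrite normrM ler_pM//.
    exact: le_trans (enorm_coord _ _) (hMc y).1.
  have t2 : `|\sum_(i < J) \sum_(j < J) (sigma y *m (sigma y)^T) i j * pd j (pd i (f x)) y|
      <= J%:R * (J%:R * ((N%:R * (Mc * Mc)) * Bf)).
    apply: (cb) => i; apply: (cb) => j; rewrite normrM ler_pM// mxE.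
    apply: le_trans (ler_norm_sum _ _ _) _.
    have -> : N%:R * (Mc * Mc) = \sum_(k < N) Mc * Mc.
      by rewrite sumr_const card_ord mulr_natl.
    apply: ler_sum => k _; rewrite normrM mxE; have [_ hs] := hMc y.
    by rewrite ler_pM.
  rewrite /Lop; apply: le_trans (ler_normD _ _) _; rewrite normrM.
  have -> : `|2^-1 : R| = 2^-1 by rewrite ger0_norm.
  by rewrite /C; lra.
Qed.

End Cover.

(** * Common radii for finitely many conditions *)

Section FiniteMin.
Variable R : realType.

Lemma seq_common_radius (T : eqType) (s : seq T) (P : T -> R -> Prop) :
  (forall k, k \in s -> exists2 e : R, 0 < e & P k e) ->
  (forall k e e', 0 < e' -> e' <= e -> P k e -> P k e') ->
  exists2 e : R, 0 < e & forall k, k \in s -> P k e.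
Proof.
move=> h mono; elim: s h => [|k s IH] h; first by exists 1.
have [|e e0 he] := IH; first by move=> l ls; apply: h; rewrite inE ls orbT.
have [e' e'0 he'] := h k (mem_head _ _).
have m0 : 0 < Num.min e e' by rewrite lt_min e0.
exists (Num.min e e') => // l; rewrite inE => /orP[/eqP->|ls].
  by apply: mono he' => //; rewrite ge_min lexx orbT.
by apply: mono (he l ls) => //; rewrite ge_min lexx.
Qed.

Lemma fin_common_radius (T : finType) (P : T -> R -> Prop) :
  (forall k, exists2 e : R, 0 < e & P k e) ->
  (forall k e e', 0 < e' -> e' <= e -> P k e -> P k e') ->
  exists2 e : R, 0 < e & forall k, P k e.
Proof.
move=> h mono; have [|//|e e0 he] := @seq_common_radius _ (enum T) P; first by move=> k _; exact: h.
by exists e => // k; apply: he; rewrite mem_enum.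
Qed.

End FiniteMin.

(** * Bumps near a given point, the bounded case, and Assumption V *)

Section LocalBumps.
Variables (R : realType) (J N : nat).
Notation vec := 'rV[R]_J.
Variables (I : finType) (phi : I -> vec -> R) (gamma : I -> vec -> vec) (V : set vec).
Variables (b : vec -> vec) (sigma : vec -> 'M[R]_(J, N)).
Hypotheses (pc : piecewise_C1_cont_refl phi gamma)
  (A2 : Assumption2' phi gamma b sigma V).

Lemma phi_continuous i : continuous (phi i).
Proof. by apply: C1_continuous; case: pc => _ [_ [h _]]. Qed.

Lemma Gbar_ge0 y i : Gbar phi y -> 0 <= phi i y.
Proof.
move=> /(proj1 (closure_enormP _ _)) h; rewrite leNgt; apply/negP => py.
have [r r0 hr] := proj1 (cvg_enormP _ _) (@phi_continuous i y) (- phi i y / 2) ltac:(lra).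
have [w Gw /hr] := h r r0; have /= := Gw i Logic.I; rewrite /Gi/= => pw.
by rewrite ler_norml; lra.
Qed.

Lemma Iset_near z : exists2 r : R, 0 < r &
  forall i y, enorm (y - z) <= r -> phi i y = 0 -> phi i z = 0.
Proof.
apply: fin_common_radius => [i|i e e' _ ee' h y yz]; last by apply: h; lra.
have [pz|pz] := eqVneq (phi i z) 0; first by exists 1.
have [|r r0 hr] := proj1 (cvg_enormP _ _) (@phi_continuous i z) (`|phi i z| / 2).
  by rewrite divr_gt0// normr_gt0.
exists r => // y /hr yz py; move: yz; rewrite py sub0r normrN.
by move: pz; rewrite -normr_gt0; lra.
Qed.

Lemma Gbar_case z : Gbar phi z -> (G phi z /\ forall i, phi i z != 0) \/ bdG phi z.
Proof.
move=> Gz; have [h|h] := pselect (G phi z); last by right; split=> // /interior_subset.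
by left; split=> // i; rewrite gt_eqF//; exact: (h i Logic.I).
Qed.

Lemma V_separated z : exists2 r : R, 0 < r & forall w, V w -> w = z \/ r <= enorm (w - z).
Proof.
have [/(finite_seqP _)[s ->] _] := A2.
have [w _|w e e' _ ee' [->|h]|r r0 hr] :=
    @seq_common_radius R _ s (fun w r => w = z \/ r <= enorm (w - z)).
- have [->|wz] := eqVneq w z; first by exists 1 => //; left.
  exists (enorm (w - z)); last by right.
  rewrite lt0r enorm_ge0 andbT; apply: contra wz => /eqP /enorm_eq0 /eqP.
  by rewrite subr_eq0.
- by left.
- by right; exact: le_trans h.
- by exists r => // w; exact: hr.
Qed.

(** At a point of [V] the quadratic term is absent: with [m = (8 / (al * r)) *: v], the inequality
    [al * |y - z| <= <v, y - z>] makes [quadr] at least 4 beyond [r / 2], and [<gamma, v> >= 0]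
    gives the sign condition. *)
Lemma unif_bumps_vertex z (eps : R) : V z -> 0 < eps ->
  exists2 r : R, 0 < r & unif_bumps phi gamma V eps (eball z r).
Proof.
move=> Vz e0; have [_ [_ hA]] := A2.
have [v [r0 [al [c1 [c2 [v1 [r00 al0] _ _ [h1 h2 _ _]]]]]]] := hA z Vz.
have [rV rV0 hV] := V_separated z.
pose r := Num.min r0 (Num.min (eps / 2) (rV / 2)).
have rpos : 0 < r by rewrite !lt_min r00/=; apply/andP; split; lra.
have [rr0 [re rv]] : r <= r0 /\ r <= eps / 2 /\ r <= rV / 2.
  by rewrite /r !ge_min !lexx !orbT.
have rne : r != 0 by rewrite gt_eqF.
have alne : al != 0 by rewrite gt_eqF.
pose kap := Num.min (r / 2) (al * r / 8).
have k0 : 0 < kap by rewrite lt_min !divr_gt0 ?mulr_gt0.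
have s0 : 0 < 8 / (al * r) by rewrite divr_gt0 ?mulr_gt0.
have mk : enorm ((8 / (al * r)) *: v) * kap + 0 * kap ^+ 2 <= 1.
  rewrite mul0r addr0 enormZ v1 mulr1 (gtr0_norm s0).
  have : kap <= al * r / 8 by rewrite ge_min lexx orbT.
  rewrite -(ler_pM2l s0) => /le_trans; apply.
  have -> : 8 / (al * r) * (al * r / 8) = 1 by field; rewrite rne alne.
  by [].
exists (kap / 2); first by lra.
have kr : kap <= r / 2 by rewrite ge_min lexx.
have re2 : 2 * r <= eps by lra.
apply: unif_bumps_sub (unif_bumps_profile phi gamma V rpos (lexx 0) k0 kr mk re2).
move=> y yz; exists z => //; split=> [w Gw wz wr|w i Gw wz pw|w /hV[->|wz]]; last 2 first.
- by left.
- by right; lra.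
- rewrite /quadr mul0r addr0 dotvZl.
  have hw : al * enorm (w - z) <= dotv v (w - z) by apply: h1 => //; exact: le_trans rr0.
  have hh : al * r / 2 <= dotv v (w - z).
    by apply: le_trans hw; rewrite -mulrA ler_pM2l// ltW.
  move: hh; rewrite -(ler_pM2l s0); apply: le_trans.
  have -> : 8 / (al * r) * (al * r / 2) = 4 by field; rewrite rne alne.
  by [].
- rewrite mulr0 scale0r addr0 dotvZr mulr_ge0 ?(ltW s0)//.
  have [|_ ]:= h2 w Gw _; last by apply.
  by rewrite /eball/=; lra.
Qed.

(** For an active [i], [phi i] is zero at [z] and nonnegative on the closure of [G], so its
    first-order expansion bounds [<n^i, y - z>] below by a small multiple of [- |y - z|]. *)
Lemma ncone_lower z n (e : R) : ncone phi z n -> 0 < e ->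
  exists2 r : R, 0 < r & forall y, Gbar phi y -> enorm (y - z) <= r ->
    - (e * enorm (y - z)) <= dotv n (y - z).
Proof.
move=> [s [s0 ->]] e0; have [_ [_ [phi1 [_ [gradn _]]]]] := pc.
pose S := 1 + \sum_i s i.
have S0 : 0 < S by rewrite ltr_pwDl// sumr_ge0.
have eS0 : 0 < e / S by rewrite divr_gt0.
have [r r0 hr] : exists2 r : R, 0 < r & forall i y, Gbar phi y -> enorm (y - z) <= r ->
    phi i z = 0 -> - (e / S * enorm (y - z)) <= dotv (nrm phi i z) (y - z).
  apply: fin_common_radius => [i|i r r' _ rr' h y Gy yz]; last by apply: h => //; lra.
  have [pz|pz] := pselect (phi i z = 0); last by exists 1.
  have g0 : 0 < enorm (grad (phi i) z).
    rewrite lt0r enorm_ge0 andbT; apply: contra (gradn i z pz) => /eqP /enorm_eq0 ->.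
    by [].
  have [|r r0 hr] := @C1_expansion _ _ (phi i) z (e / S * enorm (grad (phi i) z)) (phi1 i).
    exact: mulr_gt0.
  exists r => // y Gy /hr; rewrite [z + _]addrC subrK pz => h _.
  rewrite /nrm dotvZl ler_pdivlMl//.
  have := Gbar_ge0 i Gy; move: h; rewrite ler_norml => /andP[_]; lra.
exists r => // y Gy yz; rewrite dotv_suml.
apply: (@le_trans _ _ (\sum_(i | `[< Iset phi z i >]) - (s i * (e / S * enorm (y - z))))).
  rewrite sumrN lerN2 -mulr_suml mulrA ler_wpM2r ?enorm_ge0//.
  apply: (@le_trans _ _ (S * (e / S))); last by rewrite mulrC divfK// gt_eqF.
  rewrite ler_wpM2r ?(ltW eS0)// /S.
  have : \sum_(i | `[< Iset phi z i >]) s i <= \sum_i s i.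
    rewrite [leRHS](bigID (fun i => `[< Iset phi z i >]))/= lerDl.
    exact: sumr_ge0.
  by lra.
apply: ler_sum => i /asboolP iz; rewrite dotvZl -mulrN ler_wpM2l//.
exact: hr.
Qed.

Lemma gamma_neq0 i z : phi i z = 0 -> gamma i z != 0.
Proof.
move=> pz; have [_ [_ [_ [_ [_ [_ /(_ i z pz)]]]]]] := pc.
by apply: contraPneq => ->; rewrite dotv0r ltxx.
Qed.

Lemma dcone_gamma i z : bdG phi z -> phi i z = 0 -> dcone phi gamma z (gamma i z).
Proof.
move=> bz pz; left; split=> //; exists (fun j => (j == i)%:R); split=> //.
rewrite (bigD1 i)/=; last by apply/asboolP.
rewrite eqxx scale1r big1 ?addr0// => j /andP[_ /negbTE ->].
by rewrite scale0r.
Qed.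

Lemma Uset_uniform z : Uset phi gamma z ->
  exists2 n, ncone phi z n & forall i, phi i z = 0 -> 0 < dotv n (gamma i z).
Proof.
move=> [bz [n nn hn]]; exists n => // i pz.
by apply: hn; [exact: dcone_gamma|exact: gamma_neq0].
Qed.

(** Strict positivity at [z] survives nearby by continuity of [gamma i] on the zero set, and faces
    inactive at [z] stay inactive. One number [r] serves as radius and as constant, since shrinking
    it weakens both. *)
Lemma reflection_near z n : (forall i, phi i z = 0 -> 0 < dotv n (gamma i z)) ->
  exists2 r : R, 0 < r & forall i y, enorm (y - z) <= r -> phi i y = 0 ->
    r * enorm (gamma i y) <= dotv n (gamma i y).
Proof.
move=> hn; have [r0 r00 hI] := Iset_near z.
apply: fin_common_radius => [i|i r r' r'0 rr' h y yz py]; last first.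
  have yr : enorm (y - z) <= r by lra.
  apply: le_trans (h y yr py).
  by rewrite ler_wpM2r ?enorm_ge0.
have [pz|pz] := pselect (phi i z = 0); last first.
  by exists r0 => // y yz py; case: pz; exact: hI py.
have [_ [_ [_ [_ [_ [gc _]]]]]] := pc.
set D := dotv n (gamma i z); have D0 : 0 < D by exact: hn.
pose del := D / (2 * (enorm n + 1)).
have n0 := enorm_ge0 n.
have del0 : 0 < del by rewrite divr_gt0// mulr_gt0// ltr_wpDl.
have nb : nbhs (gamma i z) (eball (gamma i z) del) by apply/nbhs_enormP; exists del.
have [r1 r10 hr1] := proj1
  (nbhs_enormP [set y | phi i y = 0 -> eball (gamma i z) del (gamma i y)] z)
  ((proj1 (subspace_continuousP _ _) (gc i)) z pz _ nb).
(* Near [z] the inner product is at least [D / 2] and the norm of [gamma i] at most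
   [enorm (gamma i z) + del]. *)
pose th := D / 2 / (enorm (gamma i z) + del).
have gd0 : 0 < enorm (gamma i z) + del by rewrite ltr_wpDl ?enorm_ge0.
have th0 : 0 < th by rewrite !divr_gt0.
exists (Num.min r1 th); first by rewrite lt_min r10.
move=> y; rewrite le_min => /andP[/hr1 /= + _] py => /(_ py); rewrite /eball/= => yd.
apply: (@le_trans _ _ (D / 2)).
  apply: (@le_trans _ _ (th * (enorm (gamma i z) + del))); last by rewrite divfK// gt_eqF.
  rewrite ler_pM ?enorm_ge0//; first by rewrite le_min (ltW r10) ltW.
    by rewrite ge_min lexx orbT.
  by have := ler_enormD (gamma i y - gamma i z) (gamma i z); rewrite subrK; lra.
have -> : gamma i y = gamma i z + (gamma i y - gamma i z) by rewrite addrC subrK.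
rewrite dotvDr -/D.
have := dotv_leN n (gamma i y - gamma i z).
have : enorm n * enorm (gamma i y - gamma i z) <= (enorm n + 1) * del.
  by rewrite ler_pM ?enorm_ge0// lerDl.
have -> : (enorm n + 1) * del = D / 2 by rewrite /del; field; rewrite gt_eqF// ltr_wpDl.
lra.
Qed.

(** In the interior no face is active and the zero vector serves; a boundary point outside [V]
    belongs to [Uset]. *)
Lemma inner_normal z : Gbar phi z -> ~ V z ->
  exists2 n, ncone phi z n & forall i, phi i z = 0 -> 0 < dotv n (gamma i z).
Proof.
move=> Gz nVz; have [[_ hz]|bz] := Gbar_case Gz.
  exists 0; last by move=> i pz; move: (hz i); rewrite pz eqxx.
  by exists (fun=> 0); split=> //; rewrite big1// => i _; rewrite scale0r.
apply: Uset_uniform; have [_ [UV _]] := A2.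
by apply: contrapT => nU; apply: nVz; apply: UV; split.
Qed.

(** Outside [V], [admissible_cone] applies at scale [r]: [ncone_lower] with slope [th / 8] is the
    tolerance it allows, and [rV / 2] keeps the bump away from the other points of [V]. The single
    centre [z] serves the whole ball. *)
Lemma unif_bumps_local z (eps : R) : Gbar phi z -> 0 < eps ->
  exists2 r : R, 0 < r & unif_bumps phi gamma V eps (eball z r).
Proof.
move=> Gz e0; have [Vz|nVz] := pselect (V z); first exact: unif_bumps_vertex.
have [n nn hn] := inner_normal Gz nVz.
have [th th0 hth] := reflection_near hn.
have th80 : 0 < th / 8 by lra.
have [r1 r10 hr1] := ncone_lower nn th80.
have [rV rV0 hV] := V_separated z.
pose r := Num.min (Num.min th r1) (Num.min (eps / 2) (rV / 2)).
have r0 : 0 < r by rewrite !lt_min th0 r10/=; apply/andP; split; lra.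
have [rth rr1 re rv] : [/\ r <= th, r <= r1, r <= eps / 2 & r <= rV / 2].
  by rewrite /r !ge_min !lexx !orbT.
have nt : 0 <= enorm n / th by rewrite divr_ge0 ?enorm_ge0// ltW.
pose lam := (32 * (enorm n / th + 1))^-1.
have lam0 : 0 < lam by rewrite invr_gt0 mulr_gt0// ltr_wpDl.
have hlam : lam * (32 * (enorm n / th + 1)) <= 1.
  by rewrite mulVf// gt_eqF// mulr_gt0// ltr_wpDl.
have re2 : 2 * r <= eps by lra.
exists (lam * r / 2); first by rewrite divr_gt0// mulr_gt0.
apply: unif_bumps_sub (unif_bumps_cone phi gamma V th0 r0 re2 lam0 hlam).
move=> y yz; exists z => //; apply: admissible_cone => //.
- by move=> w i _ wz pw; apply: hth => //; lra.
- move=> w Gw wz; apply: le_trans (hr1 w Gw _); last by lra.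
  by rewrite lerN2 ler_wpM2l// ltW.
- by move=> w /hV[->|wz]; [left|right; lra].
Qed.

Lemma unif_bumps_bounded (M eps : R) : G phi `<=` eball 0 M -> 0 < eps ->
  unif_bumps phi gamma V eps (Gbar phi).
Proof.
move=> GM e0.
have cG : compact (Gbar phi).
  apply: (@compact_sub_eball _ _ _ 0 M); first exact: closed_closure.
  by move=> y Gy; apply: closed_eball; exact: closureS GM y Gy.
have /choice[r hr] z : exists r : R, Gbar phi z -> 0 < r /\ unif_bumps phi gamma V eps (eball z r).
  have [Gz|nG] := pselect (Gbar phi z); last by exists 0.
  by have [r r0 h] := unif_bumps_local Gz e0; exists r.
move: cG; rewrite compact_cover => /(_ _ (Gbar phi) (fun z => (eball z (r z))°)) [].
- by move=> z _; exact: open_interior.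
- move=> z Gz; exists z => //; apply/nbhs_enormP; exists (r z) => //.
  by have [] := hr z Gz.
move=> D DG hD.
apply: unif_bumps_sub (unif_bumps_bigU (s := finmap.enum_fset D) (A := fun z => eball z (r z)) _).
  by move=> y /hD[z /= zD /interior_subset yz]; exists z.
by move=> z zD; have := DG _ zD; rewrite inE => /hr[].
Qed.

Lemma AssumptionV_of_2' : AssumptionV phi gamma sigma V.
Proof.
have [fV [_ hA]] := A2; split=> // x Vx.
have [v [r [al [c1 [c2 [v1 [r0 al0] _ _ [h1 h2 _ h4]]]]]]] := hA x Vx.
exists v, al, r; split=> // y Gy yx; split; [exact: h1|exact: h4|].
move=> d [[_ [s [s0 ->]]]|[_ ->]]; last by rewrite dotv0r.
rewrite dotvC dotv_suml; apply: sumr_ge0 => i /asboolP iy.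
rewrite dotvZl mulr_ge0//; have [_] := h2 y Gy yx; exact.
Qed.

End LocalBumps.

(** * Hoffman's bound by Fourier-Motzkin elimination *)

Section Hoffman.
Variable R : realType.

(** Vectors are functions on [nat], so removing a variable changes [n] but no type. *)
Definition lin (n : nat) (a y : nat -> R) : R := \sum_(i < n) a i * y i.

Lemma linS n a y : lin n.+1 a y = lin n a y + a n * y n.
Proof. by rewrite /lin big_ord_recr. Qed.

Lemma eq_lin n a y z : (forall i, (i < n)%N -> y i = z i) -> lin n a y = lin n a z.
Proof. by move=> h; apply: eq_bigr => i _; rewrite h. Qed.

Lemma lin_comb n (s t : R) a c y :
  lin n (fun i => s * a i + t * c i) y = s * lin n a y + t * lin n c y.
Proof.
rewrite /lin !mulr_sumr -big_split; apply: eq_bigr => i _ /=.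
by rewrite mulrDl !mulrA.
Qed.

Lemma lin_dist n (A d : R) a y z : 0 <= A -> 0 <= d ->
  (forall i, (i < n)%N -> `|a i| <= A) ->
  (forall i, (i < n)%N -> `|y i - z i| <= d) ->
  `|lin n a y - lin n a z| <= n%:R * (A * d).
Proof.
move=> A0 d0 ha hyz; rewrite /lin -sumrB; apply: le_trans (ler_norm_sum _ _ _) _.
rewrite -[n in n%:R]card_ord -sumr_const mulr_suml.
by apply: ler_sum => i _; rewrite mul1r -mulrBr normrM ler_pM ?ha ?hyz.
Qed.

Section Elimination.
Variables (K : finType) (n : nat) (a : K -> nat -> R) (beta : K -> R).

(* One Fourier-Motzkin step: eliminates the variable of index [n]. *)
Definition elim_lhs (kl : K * K) : nat -> R :=
  if a kl.1 n == 0 then a kl.1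
  else if (0 < a kl.1 n) && (a kl.2 n < 0) then
    fun i => (- a kl.2 n) * a kl.1 i + a kl.1 n * a kl.2 i
  else fun=> 0.

Definition elim_rhs (kl : K * K) : R :=
  if a kl.1 n == 0 then beta kl.1
  else if (0 < a kl.1 n) && (a kl.2 n < 0) then
    (- a kl.2 n) * beta kl.1 + a kl.1 n * beta kl.2
  else 0.

(** The two weights of a combination add up to at most [2 * A], which is the growth of the error;
    [1 <= A] covers the rows that are copied. *)
Lemma elim_sound (A rho : R) y : 1 <= A -> (forall k, `|a k n| <= A) -> 0 <= rho ->
  (forall k, lin n.+1 (a k) y <= beta k + rho) ->
  forall kl, lin n (elim_lhs kl) y <= elim_rhs kl + 2 * A * rho.
Proof.
move=> A1 hA r0 h [k l]; rewrite /elim_lhs /elim_rhs /=.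
have := h k; have := h l; rewrite !linS.
have [->|ak] := eqVneq (a k n) 0; first by rewrite mul0r addr0 => _ hk; nra.
case: ifP => [/andP[k0 l0]|_] hl hk; last first.
  by rewrite /lin big1 ?add0r ?mulr_ge0// => [|i _]; [lra|rewrite mul0r].
rewrite lin_comb.
have := hA k; have := hA l; rewrite (gtr0_norm k0) (ltr0_norm l0) => lA kA.
have h1 : - a l n * (lin n (a k) y + a k n * y n) <= - a l n * (beta k + rho).
  by rewrite ler_pM2l// oppr_gt0.
have h2 : a k n * (lin n (a l) y + a l n * y n) <= a k n * (beta l + rho).
  by rewrite ler_pM2l.
have h3 : (- a l n + a k n) * rho <= 2 * A * rho by rewrite ler_wpM2r//; lra.
by lra.
Qed.

(** The rows bound the last coordinate below and above. The eliminated system puts every lower bound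
    under every upper one, and the last two hypotheses let a value within [E] of [yn] fit between
    them. *)
Lemma elim_extend (E : R) p (yn : R) : 0 <= E ->
  (forall kl, lin n (elim_lhs kl) p <= elim_rhs kl) ->
  (forall k, 0 < a k n -> a k n * (yn - E) <= beta k - lin n (a k) p) ->
  (forall k, a k n < 0 -> a k n * (yn + E) <= beta k - lin n (a k) p) ->
  exists2 t : R, `|t - yn| <= E & forall k, lin n (a k) p + a k n * t <= beta k.
Proof.
move=> E0 hp hU hL.
pose L k := (beta k - lin n (a k) p) / a k n.
(* The largest lower bound, where [yn - E] counts as one. *)
pose t := \big[Num.max/yn - E]_(l | a l n < 0) L l.
have t_ge : yn - E <= t by exact: bigmax_ge_id.
have t_le : t <= yn + E.
  apply/bigmax_leP; split; first by lra.
  by move=> l l0; rewrite /L ler_ndivrMr// mulrC hL.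
exists t; first by rewrite ler_norml; lra.
move=> k; have [k0|k0|k0] := ltgtP (a k n) 0.
- have : L k <= t by exact: le_bigmax_cond.
  by rewrite /L ler_ndivrMr// mulrC; lra.
- suff : t <= L k by rewrite /L ler_pdivlMr// mulrC; lra.
  apply/bigmax_leP; split; first by rewrite /L ler_pdivlMr// mulrC hU.
  move=> l l0; rewrite /L ler_ndivrMr// mulrAC ler_pdivrMr//.
  have := hp (k, l); rewrite /elim_lhs /elim_rhs /= gt_eqF// k0 l0 /= lin_comb.
  by lra.
- by rewrite k0 mul0r addr0; have := hp (k, k); rewrite /elim_lhs /elim_rhs /= k0 eqxx.
Qed.

End Elimination.

(** Induction on the number of variables: solve the eliminated system near [y], then choose the last
    coordinate. Feasibility is not assumed; instead [delta] is so small that an infeasible system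
    admits no approximate solution. *)
Lemma hoffman_lin n (K : finType) (a : K -> nat -> R) (beta : K -> R) :
  exists C delta : R, [/\ 0 < C, 0 < delta & forall y (rho : R), 0 <= rho -> rho <= delta ->
    (forall k, lin n (a k) y <= beta k + rho) ->
    exists2 p, (forall k, lin n (a k) p <= beta k) &
      forall i, (i < n)%N -> `|p i - y i| <= C * rho].
Proof.
elim: n K a beta => [|n IH] K a beta.
  have [k|k e e' _ ee' h /h|d d0 hd] :=
      @fin_common_radius R K (fun k e => beta k < 0 -> beta k + e < 0).
  - have [b0|b0] := ltP (beta k) 0; last by exists 1.
    by exists (- beta k / 2); lra.
  - by lra.
  exists 1, d; split=> // y rho r0 rd h; exists y => // k; rewrite /lin big_ord0 leNgt.
  by apply/negP => /hd; have := h k; rewrite /lin big_ord0; lra.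
have [C' [d' [C'0 d'0 H]]] := IH _ (elim_lhs n a) (elim_rhs n a beta).
pose A : R := 1 + \sum_k \sum_(i < n.+1) `|a k i|.
have hA k i : (i < n.+1)%N -> `|a k i| <= A.
  move=> ilt; rewrite /A (bigD1 k)//= (bigD1 (Ordinal ilt))//=.
  have s1 : 0 <= \sum_(j < n.+1 | j != Ordinal ilt) `|a k j| by exact: sumr_ge0.
  have s2 : 0 <= \sum_(j | j != k) \sum_(i < n.+1) `|a j i|.
    by apply: sumr_ge0 => j _; exact: sumr_ge0.
  by lra.
have A1 : 1 <= A by rewrite /A lerDl; apply: sumr_ge0 => j _; exact: sumr_ge0.
have [k|k e e' _ ee' h /h|am am0 ham] :=
    @fin_common_radius R K (fun k e => a k n != 0 -> e <= `|a k n|).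
- have [->|k0] := eqVneq (a k n) 0; first by exists 1.
  by exists `|a k n| => //; rewrite normr_gt0.
- exact: le_trans.
(* The error in a row is [rho] plus the effect of replacing [y] by [p]; dividing by the lower bound
   [am] of the nonzero last coefficients gives the displacement of the last coordinate, per unit of
   [rho]. *)
pose E := (1 + n%:R * (A * (C' * (2 * A)))) / am.
have E0 : 0 < E by rewrite divr_gt0// ltr_pwDl// !mulr_ge0//; lra.
exists (C' * (2 * A) + E), (d' / (2 * A)); split.
- by rewrite addr_gt0// mulr_gt0//; lra.
- by rewrite divr_gt0//; lra.
move=> y rho r0; rewrite ler_pdivlMr; last by lra.
move=> rd h.
have [||p hp hpy] := H y (2 * A * rho) _ _ (elim_sound A1 (fun k => hA k n (ltnSn n)) r0 h).
- by rewrite !mulr_ge0//; lra.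
- by lra.
have dl k : `|lin n (a k) p - lin n (a k) y| <= n%:R * (A * (C' * (2 * A * rho))).
  apply: lin_dist => //; first by lra.
    by rewrite !mulr_ge0//; lra.
  by move=> i ilt; apply: hA; rewrite ltnW.
have Er k : a k n != 0 -> rho + n%:R * (A * (C' * (2 * A * rho))) <= `|a k n| * (E * rho).
  move=> /ham hk; apply: (@le_trans _ _ (am * (E * rho))).
    have -> : am * (E * rho) = (1 + n%:R * (A * (C' * (2 * A)))) * rho.
      by rewrite mulrA; congr (_ * _); rewrite /E mulrC divfK// gt_eqF.
    by lra.
  by rewrite ler_wpM2r// mulr_ge0// ltW.
have Er0 : 0 <= E * rho by rewrite mulr_ge0// ltW.
have [k k0|k k0|t ty ht] := elim_extend (yn := y n) Er0 hp.
- have := h k; rewrite linS; have := Er k; rewrite gt_eqF// (gtr0_norm k0) => /(_ isT).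
  by have := dl k; rewrite ler_norml => /andP[]; lra.
- have := h k; rewrite linS; have := Er k; rewrite lt_eqF// (ltr0_norm k0) => /(_ isT).
  by have := dl k; rewrite ler_norml => /andP[]; lra.
exists (fun i => if (i < n)%N then p i else t).
  move=> k; rewrite linS ltnn; apply: le_trans (ht k); rewrite lerD2r.
  by rewrite (@eq_lin _ _ _ p)// => i ->.
move=> i; rewrite ltnS leq_eqVlt => /orP[/eqP->|ilt].
  rewrite ltnn; apply: le_trans ty _; rewrite ler_wpM2r// lerDr.
  by rewrite !mulr_ge0//; lra.
rewrite ilt; apply: le_trans (hpy i ilt) _.
by rewrite mulrA ler_wpM2r// lerDl ltW.
Qed.

Variable J : nat.
Notation vec := 'rV[R]_J.

Lemma hoffman (K : finType) (a : K -> vec) (beta : K -> R) :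
  exists C delta : R, [/\ 0 < C, 0 < delta & forall (y : vec) (rho : R), 0 <= rho ->
    rho <= delta -> (forall k, dotv (a k) y <= beta k + rho) ->
    exists2 p : vec, (forall k, dotv (a k) p <= beta k) & enorm (p - y) <= C * rho].
Proof.
pose ext (u : vec) (i : nat) : R := if insub i is Some j then u 0 j else 0.
have extE u (j : 'I_J) : ext u j = u 0 j by rewrite /ext valK.
have dotE u w : dotv u w = lin J (ext u) (ext w).
  by apply: eq_bigr => i _; rewrite !extE.
have [C [d [C0 d0 H]]] := hoffman_lin J (fun k => ext (a k)) beta.
exists ((J%:R + 1) * C), d; split=> //; first by rewrite mulr_gt0// ltr_wpDl.
move=> y rho r0 rd h.
have [k|p hp py] := H (ext y) rho r0 rd; first by rewrite -dotE.
exists (\row_j p j).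
  move=> k; apply: le_trans (hp k); rewrite dotE.
  rewrite (@eq_lin _ _ _ p)// => i ilt; have := extE (\row_j p j) (Ordinal ilt).
  by rewrite mxE.
apply: (@le_trans _ _ (J%:R * (C * rho))).
  apply: enorm_le_sum; last by rewrite mulr_ge0// ltW.
  by move=> i; rewrite !mxE -(extE y i); exact: py.
by rewrite -mulrA ler_wpM2r ?lerDl// mulr_ge0// ltW.
Qed.

End Hoffman.

(** * A constant unit normal on the zero set forces a half-space *)

Section HalfSpace.
Variables (R : realType) (J : nat).
Notation vec := 'rV[R]_J.
Implicit Types (x y z v : vec).

Lemma continuous_line (f : vec -> R) x v : continuous f ->
  continuous (fun t : R => f (x + t *: v)).
Proof.
move=> cf t; apply/cvgrPdist_le => e e0.
have [r r0 hr] := proj1 (cvg_enormP f (x + t *: v)) (cf _) e e0.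
have v0 : 0 < enorm v + 1 by rewrite ltr_wpDl ?enorm_ge0.
near=> s; rewrite distrC; apply: hr.
rewrite opprD addrACA subrr add0r -scalerBl enormZ distrC.
have st : `|t - s| <= r / (enorm v + 1).
  by near: s; apply: cvgr_dist_le; rewrite // divr_gt0.
move: st; rewrite ler_pdivlMr// mulrDr mulr1; apply: le_trans.
by rewrite lerDl.
Unshelve. all: by end_near. Qed.

Lemma continuous_sign (p : R -> R) (s : R) : continuous p -> 0 < p s ->
  exists2 e : R, 0 < e & forall t, `|t - s| <= e -> 0 < p t.
Proof.
move=> cp ps; have := cp s; move=> /cvgrPdist_lt /(_ _ ps) /nbhs_ballP[e /= e0 he].
exists (e / 2); first by lra.
move=> t ts; have := he t; rewrite /= -ball_normE /= distrC => /(_ _).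
have h : `|t - s| < e by lra.
move=> /(_ h); rewrite ltr_norml => /andP[_]; lra.
Qed.

Variables (f : vec -> R) (n0 : vec).
Hypotheses (f1 : C1 f)
  (hn : forall x, f x = 0 -> grad f x != 0 /\ (enorm (grad f x))^-1 *: grad f x = n0).

(** The gradient at a zero is a positive multiple of [n0], and for small [t] the remainder is at
    most half the linear term. *)
Lemma crossing x e : f x = 0 -> 0 < dotv n0 e -> exists2 d : R, 0 < d &
  forall t, 0 < t -> t <= d -> 0 < f (x + t *: e) /\ f (x - t *: e) < 0.
Proof.
move=> fx ne; have [g0 gn] := hn fx.
have gp : 0 < enorm (grad f x).
  by rewrite lt0r enorm_ge0 andbT; apply: contra g0 => /eqP/enorm_eq0 ->.
set c := dotv (grad f x) e.
have c0 : 0 < c.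
  have -> : c = enorm (grad f x) * dotv n0 e.
    by rewrite -gn dotvZl mulrA mulfV ?mul1r// gt_eqF.
  exact: mulr_gt0.
have e1 : 0 < enorm e + 1 by rewrite ltr_wpDl ?enorm_ge0.
have eps0 : 0 < c / (2 * (enorm e + 1)) by rewrite divr_gt0// mulr_gt0.
have [r r0 hr] := C1_expansion x f1 eps0.
exists (r / (enorm e + 1)); first by rewrite divr_gt0.
move=> t t0; rewrite ler_pdivlMr// => tr.
have key : c / (2 * (enorm e + 1)) * (t * enorm e) <= t * c / 2.
  have -> : t * c / 2 = c / (2 * (enorm e + 1)) * (t * (enorm e + 1)).
    by field; rewrite gt_eqF.
  by rewrite ler_pM2l// ler_pM2l// lerDl.
have tc0 : 0 < t * c by rewrite mulr_gt0.
have ter : enorm (t *: e) <= r.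
  by rewrite enormZ (gtr0_norm t0); apply: le_trans tr; rewrite ler_pM2l// lerDl.
split.
  have := hr _ ter; rewrite fx dotvZr -/c enormZ (gtr0_norm t0) subr0 ler_norml.
  by lra.
have := hr (- (t *: e)); rewrite enormN => /(_ ter).
rewrite fx dotvNr dotvZr -/c enormZ (gtr0_norm t0) subr0 ler_norml.
by lra.
Qed.

(* After a zero, [f] stays positive along a direction entering the half-space:
   the first return to [f <= 0] would be a zero crossed in the wrong direction. *)
Lemma pos_side z y : f z = 0 -> 0 < dotv n0 (y - z) -> 0 < f y.
Proof.
move=> fz ne; rewrite ltNge; apply/negP => fy.
set e := y - z in ne.
pose p t := f (z + t *: e).
have cp : continuous p by apply: continuous_line; exact: C1_continuous.
have p1 : p 1 <= 0 by rewrite /p scale1r /e addrC subrK.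
have [d d0 hd] := crossing fz ne.
pose d' := Num.min d 1.
have d'0 : 0 < d' by rewrite lt_min d0 ltr01.
have pd' : 0 < p d' by case: (hd d' d'0) => //; rewrite ge_min lexx.
(* Starting at [d'] excludes the zero at [t = 0]; the infimum of [Z] is the first return. *)
pose Z : set R := [set t | d' <= t /\ p t <= 0].
have Z1 : Z 1 by split=> //; rewrite ge_min lexx orbT.
have hinf : has_inf Z by split; [exists 1|exists d' => t []].
set s := inf Z.
have sd : d' <= s by apply: lb_le_inf => [|t []]; [exists 1|].
have before t : d' <= t -> t < s -> 0 < p t.
  move=> dt ts; rewrite ltNge; apply/negP => pt.
  by have := ge_inf hinf.2 (conj dt pt); rewrite -/s leNgt ts.
have ps : p s <= 0.
  rewrite leNgt; apply/negP => /(continuous_sign cp)[eta eta0 heta].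
  have [t [dt pt] ts] := inf_adherent eta0 hinf.
  have := ge_inf hinf.2 (conj dt pt); rewrite -/s => st.
  have := heta t; rewrite ger0_norm ?subr_ge0// => h.
  by have := h ltac:(rewrite -/s in ts; lra); lra.
have sd' : d' < s.
  by rewrite lt_neqAle sd andbT; apply: contraTneq ps => <-; rewrite -ltNge.
have ps0 : f (z + s *: e) = 0.
  apply/eqP; rewrite eq_le; apply/andP; split; first exact: ps.
  rewrite leNgt; apply/negP => pneg.
  have cNp : continuous (fun t => - p t) by move=> t; apply: cvgN; exact: cp.
  have [|eta eta0 heta] := @continuous_sign (fun t => - p t) s cNp; first by rewrite oppr_gt0.
  pose t := Num.max d' (s - eta).
  have ts : t < s by rewrite gt_max sd'/=; lra.
  have tge : s - eta <= t by rewrite le_max lexx orbT.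
  have dt : d' <= t by rewrite le_max lexx.
  have := before t dt ts; have := heta t; rewrite ler0_norm; last by lra.
  by move=> h; have := h ltac:(lra); lra.
have [d2 d20 hd2] := crossing ps0 ne.
pose t := Num.min d2 ((s - d') / 2).
have t0 : 0 < t by rewrite lt_min d20; lra.
have td : t <= d2 by rewrite ge_min lexx.
have td' : t <= (s - d') / 2 by rewrite ge_min lexx orbT.
have [_] := hd2 t t0 td; rewrite -addrA -scalerBl -/(p (s - t)).
by have := before (s - t) ltac:(lra) ltac:(lra); lra.
Qed.

(** If [f y] were positive, the segment from [y] would meet a zero before reaching [z], because [f]
    is negative just before [z]; [pos_side] from that zero would make [f z] positive. *)
Lemma neg_side z y : f z = 0 -> dotv n0 (y - z) < 0 -> f y < 0.
Proof.
move=> fz ne.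
have ne' : 0 < dotv n0 (z - y) by rewrite -opprB dotvNr oppr_gt0.
rewrite ltNge; apply/negP; rewrite le_eqVlt => /orP[/eqP fy|fy].
  by have := pos_side (esym fy) ne'; rewrite fz ltxx.
pose p t := f (y + t *: (z - y)).
have cp : continuous p by apply: continuous_line; exact: C1_continuous.
have [d d0 hd] := crossing fz ne'.
pose t := Num.min d 2^-1.
have t0 : 0 < t by rewrite lt_min d0 invr_gt0 ltr0n.
have td : t <= d by rewrite ge_min lexx.
have t2 : t <= 2^-1 by rewrite ge_min lexx orbT.
have [_ ft] := hd t t0 td.
have p1t : p (1 - t) < 0.
  rewrite /p scalerBl scale1r addrA [y + _]addrC subrK; exact: ft.
have p0 : 0 < p 0 by rewrite /p scale0r addr0.
have [|||c] := @IVT _ p 0 (1 - t) 0.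
- by lra.
- exact: continuous_subspaceT.
- by rewrite ge_min le_max (ltW p0) (ltW p1t) orbT.
rewrite in_itv/= => /andP[c0 c1] pc.
have := pos_side (y := z) pc.
have -> : z - (y + c *: (z - y)) = (1 - c) *: (z - y).
  by rewrite opprD addrA scalerBl scale1r.
by rewrite dotvZr fz ltxx mulr_gt0//; [move=> /(_ isT)|lra].
Qed.

(** On the hyperplane itself a nonzero value would keep its sign after a short move along [n0] or
    [- n0], against [pos_side] or [neg_side]. *)
Lemma halfspace_sign z y : f z = 0 ->
  (f y = 0 <-> dotv n0 (y - z) = 0) /\ (0 < f y <-> 0 < dotv n0 (y - z)).
Proof.
move=> fz.
have n01 : dotv n0 n0 = 1.
  have [g0 <-] := hn fz.
  have gp : enorm (grad f z) != 0.
    by apply: contra g0 => /eqP/enorm_eq0 ->.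
  by rewrite dotvZl dotvZr -enorm_sqr; field.
have zero : dotv n0 (y - z) = 0 -> f y = 0.
  move=> d0.
  have cp := @continuous_line f y n0 (C1_continuous f1).
  have sh t : dotv n0 (y + t *: n0 - z) = t.
    by rewrite addrAC dotvDr d0 add0r dotvZr n01 mulr1.
  apply/eqP; rewrite eq_le; apply/andP; split; rewrite leNgt; apply/negP => fy.
    have [|e e0 he] := @continuous_sign _ 0 cp; first by rewrite scale0r addr0.
    have := he (- e); rewrite subr0 normrN gtr0_norm// => /(_ (lexx _)).
    by have := neg_side (y := y + - e *: n0) fz; rewrite sh oppr_lt0 => /(_ e0); lra.
  have cNp : continuous (fun t : R => - f (y + t *: n0)) by move=> t; apply: cvgN; exact: cp.
  have [|e e0 he] := @continuous_sign _ 0 cNp; first by rewrite scale0r addr0 oppr_gt0.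
  have := he e; rewrite subr0 gtr0_norm// => /(_ (lexx _)).
  by have := pos_side (y := y + e *: n0) fz; rewrite sh => /(_ e0); lra.
have := @pos_side z y fz; have := @neg_side z y fz.
by case: (ltgtP (dotv n0 (y - z)) 0) => [h /(_ isT)|h _ /(_ isT)|h _ _];
  split; split=> // ?; rewrite ?zero//; lra.
Qed.

End HalfSpace.

(** Otherwise the cardinal would grow at [#|I|.+1] consecutive steps. *)
Lemma chain_stabilizes (I : finType) (F : nat -> {set I}) :
  (forall j, F j \subset F j.+1) -> exists2 j, (j <= #|I|)%N & F j = F j.+1.
Proof.
move=> mono; apply: contrapT => h.
suff lb j : (j <= #|I|.+1)%N -> (j <= #|F j|)%N.
  by have := leq_trans (lb _ (leqnn _)) (max_card _); rewrite ltnn.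
elim: j => // j IH jI; apply: leq_ltn_trans (IH (ltnW jI)) _.
apply: proper_card; rewrite finset.properEneq mono andbT; apply/eqP => E.
by apply: h; exists j.
Qed.

(** * The polyhedral case *)

Section Polyhedral.
Variables (R : realType) (J N : nat).
Notation vec := 'rV[R]_J.
Variables (I : finType) (phi : I -> vec -> R) (gamma : I -> vec -> vec) (V : set vec).
Variables (b : vec -> vec) (sigma : vec -> 'M[R]_(J, N)).
Hypotheses (ph : polyhedral_const_refl phi gamma)
  (A2 : Assumption2' phi gamma b sigma V).

Let pc : piecewise_C1_cont_refl phi gamma := ph.1.

(** The norm is only bounded by 1, so that [n i = 0] can encode a [phi i] without zeros. *)
Definition halfspace_data (n : I -> vec) (c : I -> R) (g : I -> vec) :=
  forall i, enorm (n i) <= 1 /\ forall y,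
    [/\ phi i y = 0 <-> dotv (n i) y = c i, 0 < phi i y <-> c i < dotv (n i) y &
        phi i y = 0 -> nrm phi i y = n i /\ gamma i y = g i].

Lemma polyhedral_halfspaces : exists n c g, halfspace_data n c g.
Proof.
suff /choice[d hd] i : exists d : vec * R * vec, enorm d.1.1 <= 1 /\ forall y,
    [/\ phi i y = 0 <-> dotv d.1.1 y = d.1.2, 0 < phi i y <-> d.1.2 < dotv d.1.1 y &
        phi i y = 0 -> nrm phi i y = d.1.1 /\ gamma i y = d.2].
  by exists (fun i => (d i).1.1), (fun i => (d i).1.2), (fun i => (d i).2).
have [[x0 Gx0] [_ [phi1 [_ [gradn _]]]]] := pc.
have [n0 [g0 h0]] := ph.2 i.
have [[z pz]|nz] := pselect (exists z, phi i z = 0).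
  exists (n0, dotv n0 z, g0); split=> /=.
    rewrite -(h0 z pz).1 /nrm enormZ ger0_norm ?invr_ge0 ?enorm_ge0// mulVf//.
    by apply: contra (gradn i z pz) => /eqP/enorm_eq0 ->.
  move=> y; have hn x : phi i x = 0 -> grad (phi i) x != 0 /\
      (enorm (grad (phi i) x))^-1 *: grad (phi i) x = n0.
    by move=> px; split; [exact: gradn|exact: (h0 x px).1].
  have [[e1 e2] [p1 p2]] := halfspace_sign (phi1 i) hn y pz.
  move: e1 e2 p1 p2; rewrite dotvDr dotvNr => e1 e2 p1 p2.
  by split; [split=> [/e1|h]; [lra|apply: e2; lra]|
    split=> [/p1|h]; [lra|apply: p2; lra]|exact: h0].
(* Without zeros [phi i] is positive everywhere, by the intermediate value theorem on segments from
   a point of [G]; it is encoded by [-1 < 0]. *)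
exists (0, -1, 0); split=> /=; first by rewrite enorm0.
move=> y; rewrite dotv0l.
have py : 0 < phi i y.
  rewrite ltNge; apply/negP => py.
  have p0 : 0 < phi i x0 by exact: (Gx0 i Logic.I).
  have cp := @continuous_line _ _ (phi i) x0 (y - x0) (C1_continuous (phi1 i)).
  have [|t _ pt] := @IVT _ _ 0 1 0 ler01 (continuous_subspaceT cp).
    by rewrite scale0r addr0 scale1r addrC subrK ge_min le_max py orbT (ltW p0).
  by apply: nz; exists (x0 + t *: (y - x0)).
have pn : phi i y <> 0 by apply/eqP; rewrite gt_eqF.
by split; split=> // h; lra.
Qed.

Variables (n : I -> vec) (c : I -> R) (g : I -> vec).
Hypothesis hd : halfspace_data n c g.

(** For the converse, a slight move towards a point of [G] makes all the inequalities strict. *)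
Lemma Gbar_halfspaces y : Gbar phi y <-> forall i, c i <= dotv (n i) y.
Proof.
split=> [Gy i|h].
  have [_ /(_ y)[[e1 _] [p1 _] _]] := hd i; have := Gbar_ge0 pc i Gy.
  by rewrite le_eqVlt => /orP[/eqP/esym/e1 ->|/p1/ltW].
have [[x0 Gx0] _] := pc.
apply/closure_enormP => r r0.
have d0 : 0 < enorm (x0 - y) + 1 by rewrite ltr_wpDl ?enorm_ge0.
pose t := Num.min 1 (r / (enorm (x0 - y) + 1)).
have t0 : 0 < t by rewrite lt_min ltr01 divr_gt0.
have t1 : t <= 1 by rewrite ge_min lexx.
have tr : t <= r / (enorm (x0 - y) + 1) by rewrite ge_min lexx orbT.
exists (y + t *: (x0 - y)); last first.
  rewrite addrAC subrr add0r enormZ (gtr0_norm t0).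
  move: tr; rewrite ler_pdivlMr// mulrDr mulr1; apply: le_trans.
  by rewrite lerDl ltW.
move=> i _; have [_ hi] := hd i; have [_ [_ p2] _] := hi (y + t *: (x0 - y)).
have [_ [p1 _] _] := hi x0; have := p1 (Gx0 i Logic.I) => gx0.
apply: p2; rewrite dotvDr dotvZr dotvDr dotvNr.
by have := h i; nra.
Qed.

Definition has_face (K : {set I}) :=
  exists z, [/\ Gbar phi z, ~ V z & forall i, (phi i z = 0) <-> i \in K].

(** Normals and reflection directions are constant, so the vector found at one point with active set
    [K] works along the whole face. [has_face] is a premise inside the conclusion so that [m] and
    [th] can be chosen for every [K]. *)
Lemma face_normal K : exists m : vec, exists2 th : R, 0 < th & has_face K ->
  (forall y z, Gbar phi y -> (forall i, i \in K -> dotv (n i) z = c i) ->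
     0 <= dotv m (y - z)) /\
  (forall i, i \in K -> th * enorm (g i) <= dotv m (g i)).
Proof.
have [[z [Gz Vz zK]]|nf] := pselect (has_face K); last by exists 0, 1.
have [m [s [s0 mE]] hm] := inner_normal pc A2 Gz Vz.
have [th th0 hth] := reflection_near pc hm.
exists m, th => // _; split=> [y w Gy hw|i iK].
  rewrite mE dotv_suml; apply: sumr_ge0 => i /asboolP iz.
  have [_ /(_ z)[_ _ /(_ iz)[-> _]]] := hd i.
  rewrite dotvZl mulr_ge0// dotvDr dotvNr hw; last by apply/zK.
  by have := proj1 (Gbar_halfspaces y) Gy i; lra.
have pz : phi i z = 0 by apply/zK.
have [_ /(_ z)[_ _ /(_ pz)[_ <-]]] := hd i.
by apply: hth => //; rewrite subrr enorm0 ltW.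
Qed.

Lemma hoffman_face : exists2 h : R, 0 < h & forall (K : {set I}) y (rho : R),
  Gbar phi y -> 0 <= rho -> rho <= h -> (forall i, i \in K -> dotv (n i) y <= c i + rho) ->
  exists p, [/\ Gbar phi p, forall i, i \in K -> dotv (n i) p = c i &
                h * enorm (p - y) <= rho].
Proof.
apply: fin_common_radius => [K|K e e' e'0 ee' H y rho Gy r0 re hK]; last first.
  have [p [Gp hp pd]] := H y rho Gy r0 (le_trans re ee') hK.
  by exists p; split=> //; apply: le_trans pd; rewrite ler_wpM2r ?enorm_ge0.
(* Rows [(i, false)] describe the closure of [G], rows [(i, true)] the reverse inequalities on [K];
   for [i] outside [K] the latter read [0 <= 0]. *)
pose a (k : I * bool) : vec := if k.2 then (if k.1 \in K then n k.1 else 0) else - n k.1.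
pose beta (k : I * bool) : R := if k.2 then (if k.1 \in K then c k.1 else 0) else - c k.1.
have [C [d [C0 d0 H]]] := hoffman a beta.
exists (Num.min d C^-1); first by rewrite lt_min d0 invr_gt0.
move=> y rho Gy r0; rewrite le_min => /andP[rd _] hK.
have [|p hp py] := H y rho r0 rd.
  move=> [i [|]]; rewrite /a /beta /=.
    by case: ifP => [/hK//|_]; rewrite dotv0l add0r.
  by rewrite dotvNl; have := proj1 (Gbar_halfspaces y) Gy i; lra.
have Gp : Gbar phi p.
  by apply/Gbar_halfspaces => i; have := hp (i, false); rewrite /a /beta /= dotvNl lerN2.
exists p; split=> //.
  move=> i iK; have := hp (i, true); rewrite /a /beta /= iK => h1.
  by apply/eqP; rewrite eq_le h1; exact: (proj1 (Gbar_halfspaces p) Gp i).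
apply: (@le_trans _ _ (C^-1 * enorm (p - y))).
  by rewrite ler_wpM2r ?enorm_ge0// ge_min lexx orbT.
by rewrite ler_pdivrMl.
Qed.

Lemma unif_bumps_near_V (eps : R) : 0 < eps -> exists2 r : R, 0 < r &
  unif_bumps phi gamma V eps [set y | exists2 w, V w & enorm (y - w) <= r].
Proof.
move=> e0; have [/(finite_seqP _)[s Vs] _] := A2.
have [w ws|w r r' _ rr'|r r0 hr] :=
    @seq_common_radius R _ s (fun w r => unif_bumps phi gamma V eps (eball w r)).
- by apply: (unif_bumps_vertex A2) => //; rewrite Vs.
- by apply: unif_bumps_sub => y; rewrite /eball/= => yw; exact: le_trans rr'.
exists r => //; apply: unif_bumps_sub (unif_bumps_bigU hr).
by move=> y [w Vw yw]; exists w => //; rewrite Vs in Vw.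
Qed.

(* [y] is at distance at most [s] from the faces in [K] and more than [t >> s] from
   the others; it is covered by a bump of size [t / 2] centred at a point [z] of the
   face [K] close to [y]. *)
Lemma face_cover K m (th h lam rV s t : R) y :
  0 < th -> 0 < h -> 0 < lam -> 32 * lam <= 1 -> 0 < s -> s <= h -> 0 < t -> 2 * t <= rV ->
  s <= lam * h / 4 * t ->
  (has_face K ->
    (forall y z, Gbar phi y -> (forall i, i \in K -> dotv (n i) z = c i) ->
       0 <= dotv m (y - z)) /\
    (forall i, i \in K -> th * enorm (g i) <= dotv m (g i))) ->
  (exists p, [/\ Gbar phi p, forall i, i \in K -> dotv (n i) p = c i &
                h * enorm (p - y) <= s]) ->
  (forall w, V w -> rV < enorm (y - w)) ->
  (forall i, i \notin K -> c i + t < dotv (n i) y) ->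
  exists2 z, admissible phi gamma V ((32 / (th * (t / 2))) *: m) (32 / (t / 2) ^+ 2) (t / 2) z &
    enorm (y - z) <= lam * (t / 2) / 2.
Proof.
move=> th0 h0 l0 l1 s0 sh t0 tV st hK [z [Gz zK zy]] yV yK.
have zyd : enorm (z - y) <= lam * t / 4.
  by rewrite -(ler_pM2l h0); lra.
have lt1 : lam * t <= t / 32 by nra.
(* The margin [t] at [y] exceeds the displacement, at most [t / 2] plus [lam * t / 4]. *)
have far i w : i \notin K -> enorm (w - z) <= t / 2 -> c i < dotv (n i) w.
  move=> iK wz; have := yK i iK; have [ni _] := hd i.
  have -> : w = y + ((w - z) + (z - y)) by rewrite [w - z + (z - y)]addrA subrK [y + _]addrC subrK.
  rewrite dotvDr; have := dotv_leN (n i) (w - z + (z - y)).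
  have := ler_enormD (w - z) (z - y); have := enorm_ge0 (w - z + (z - y)).
  by nra.
have nVz w : V w -> 2 * (t / 2) <= enorm (w - z).
  by move=> /yV; have := ler_edistD z y w; rewrite (enorm_distC y z) (enorm_distC z w); lra.
have phiK w i : Gbar phi w -> enorm (w - z) <= t / 2 -> phi i w = 0 -> i \in K.
  move=> Gw wz pw; apply: contraT => iK; have := far i w iK wz.
  have [_ /(_ w)[[e1 _] _ _]] := hd i.
  by rewrite e1// ltxx.
have face : has_face K.
  exists z; split=> //.
    by move=> /nVz; rewrite subrr enorm0; lra.
  move=> i; have [_ /(_ z)[[_ e2] _ _]] := hd i; split=> [|/zK/e2//].
  by apply: phiK => //; rewrite subrr enorm0; lra.
have [hn hg] := hK face.
exists z; last by rewrite enorm_distC; lra.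
apply: admissible_cone => //.
- by lra.
- move=> w i Gw wz pw; have [_ /(_ w)[_ _ /(_ pw)[_ ->]]] := hd i.
  by apply: hg; exact: phiK pw.
- move=> w Gw wz; apply: (@le_trans _ _ 0); last exact: hn.
  by rewrite oppr_le0 mulr_ge0//; lra.
- by move=> w Vw; right; exact: nVz.
Qed.

(** Points near [V] use the bumps there; every other point falls into one of finitely many classes,
    indexed by a scale and a set of faces, each with uniform bumps. *)
Lemma unif_bumps_halfspaces (eps : R) : 0 < eps -> unif_bumps phi gamma V eps (Gbar phi).
Proof.
move=> e0.
have [rV rV0 hV] := unif_bumps_near_V e0.
have /choice[m hm] := face_normal.
have /choice[th hth] K : exists th : R, 0 < th /\ (has_face K ->
  (forall y z, Gbar phi y -> (forall i, i \in K -> dotv (n i) z = c i) ->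
     0 <= dotv (m K) (y - z)) /\
  (forall i, i \in K -> th * enorm (g i) <= dotv (m K) (g i))).
  by have [th th0 h] := hm K; exists th.
have [K|K e e' e'0 ee'|lam l0 hlam] := @fin_common_radius R {set I}
    (fun K lam => lam * (32 * (enorm (m K) / th K + 1)) <= 1).
- have nt : 0 <= enorm (m K) / th K by rewrite divr_ge0 ?enorm_ge0// ltW//; case: (hth K).
  exists (32 * (enorm (m K) / th K + 1))^-1; first by rewrite invr_gt0 mulr_gt0// ltr_wpDl.
  by rewrite mulVf// gt_eqF// mulr_gt0// ltr_wpDl.
- have nt : 0 <= enorm (m K) / th K by rewrite divr_ge0 ?enorm_ge0// ltW//; case: (hth K).
  by apply: le_trans; rewrite ler_wpM2r// mulr_ge0// addr_ge0.
have l1 : 32 * lam <= 1.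
  have nt : 0 <= enorm (m finset.set0) / th finset.set0.
    by rewrite divr_ge0 ?enorm_ge0// ltW//; case: (hth finset.set0).
  by have := hlam finset.set0; nra.
have [h h0 hh] := hoffman_face.
(* The three bounds serve Hoffman's estimate, the distance to [V] and the size of the supports. *)
pose top := Num.min h (Num.min (rV / 2) eps).
have top0 : 0 < top by rewrite !lt_min h0 e0 divr_gt0.
have [toph topV tope] : [/\ top <= h, top <= rV / 2 & top <= eps].
  by rewrite /top !ge_min !lexx !orbT.
pose eta := Num.min 1 (lam * h / 4).
have eta0 : 0 < eta by rewrite lt_min ltr01 divr_gt0// mulr_gt0.
have eta1 : eta <= 1 by rewrite ge_min lexx.
have etal : eta <= lam * h / 4 by rewrite ge_min lexx orbT.
(* The scales increase to [top], reached at [#|I|.+1]; as the subtraction truncates, consecutive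
   scales have ratio [eta] only for [j <= #|I|]. *)
pose sc j := top * eta ^+ (#|I|.+1 - j).
have sc0 j : 0 < sc j by rewrite mulr_gt0// exprn_gt0.
have sct j : sc j <= top.
  by rewrite -[leRHS]mulr1 ler_pM2l// exprn_ile1// ltW.
have scS j : (j <= #|I|)%N -> sc j <= lam * h / 4 * sc j.+1.
  move=> jI; rewrite /sc subSS subSn// exprS mulrCA ler_wpM2r//.
  by rewrite mulr_ge0 ?exprn_ge0// ltW.
have scm j : sc j <= sc j.+1.
  rewrite /sc ler_pM2l// ler_wiXn2l ?(ltW eta0)//.
  by rewrite leq_sub2l.
pose A (jK : 'I_(#|I|.+1) * {set I}) : set vec := [set y | exists2 z,
    admissible phi gamma V ((32 / (th jK.2 * (sc jK.1.+1 / 2))) *: m jK.2)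
      (32 / (sc jK.1.+1 / 2) ^+ 2) (sc jK.1.+1 / 2) z &
    enorm (y - z) <= lam * (sc jK.1.+1 / 2) / 2].
have hA jK : jK \in enum {: 'I_(#|I|.+1) * {set I}} -> unif_bumps phi gamma V eps (A jK).
  move=> _; apply: unif_bumps_cone => //.
  - by case: (hth jK.2).
  - by rewrite divr_gt0.
  - by have := sct jK.1.+1; lra.
apply: unif_bumps_sub (unif_bumpsU hV (unif_bumps_bigU hA)) => y Gy.
have [[w [Vw yw]]|far] := pselect (exists w, V w /\ enorm (y - w) <= rV).
  by left; exists w.
right; pose F j := [set i | dotv (n i) y <= c i + sc j]%SET.
(* Equality of [F j] and [F j.+1] leaves no face at a level between the two scales, which is the gap
   required by [face_cover]. *)
have [j|j jI FE] := @chain_stabilizes I F.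
  by apply/fintype.subsetP => i; rewrite !inE => /le_trans; apply; rewrite lerD2l.
have jlt : (j < #|I|.+1)%N by rewrite ltnS.
exists (Ordinal jlt, F j); first by rewrite mem_enum.
have [thp hthp] := hth (F j).
apply: (@face_cover (F j) (m (F j)) (th (F j)) h lam rV (sc j) (sc j.+1)) => //.
- exact: le_trans (sct j) toph.
- by have := sct j.+1; lra.
- exact: scS.
- apply: hh => //; first exact: ltW.
    exact: le_trans (sct j) toph.
  by move=> i; rewrite inE.
- move=> w Vw; rewrite ltNge; apply/negP => yw.
  by apply: far; exists w.
- by move=> i; rewrite FE inE -ltNge.
Qed.

End Polyhedral.

Lemma unif_bumps_polyhedral (R : realType) (J N : nat) (I : finType)
  (phi : I -> 'rV[R]_J -> R) (gamma : I -> 'rV[R]_J -> 'rV[R]_J)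
  (b : 'rV[R]_J -> 'rV[R]_J) (sigma : 'rV[R]_J -> 'M[R]_(J, N))
  (V : set 'rV[R]_J) (eps : R) :
  polyhedral_const_refl phi gamma -> Assumption2' phi gamma b sigma V -> 0 < eps ->
  unif_bumps phi gamma V eps (Gbar phi).
Proof.
move=> ph A2 e0; have [n [c [g hd]]] := polyhedral_halfspaces ph.
exact: (unif_bumps_halfspaces ph A2 hd).
Qed.

Theorem theorem3p5 (R : realType) (J N : nat) (I : finType)
  (phi : I -> 'rV[R]_J -> R) (gamma : I -> 'rV[R]_J -> 'rV[R]_J)
  (b : 'rV[R]_J -> 'rV[R]_J) (sigma : 'rV[R]_J -> 'M[R]_(J, N))
  (V : set 'rV[R]_J) :
  ((piecewise_C1_cont_refl phi gamma /\
      exists M : R, G phi `<=` eball 0 M)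
   \/ polyhedral_const_refl phi gamma) ->
  V `<=` bdG phi ->
  Assumption2' phi gamma b sigma V ->
  continuous b -> continuous sigma ->
  (exists M : R, forall x, enorm (b x) <= M /\ forall i j, `|sigma x i j| <= M) ->
  AssumptionTF phi gamma b sigma V /\ AssumptionV phi gamma sigma V.
Proof.
move=> hG _ A2 _ _ hM; split; last exact: AssumptionV_of_2' A2.
apply: TF_of_unif_bumps hM _ => eps e0; case: hG => [[pc [M GM]]|ph].
  exact: (unif_bumps_bounded pc A2 GM e0).
exact: (unif_bumps_polyhedral ph A2 e0).
Qed.
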